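(* For every $P_{\rm r}>0$ and $\mathcal C_x\in[0,1)$, the ergodic rate $\mathcal R_{\rm E-E}=\mathbb E[\min(R_{\rm sr},R_{\rm rd})]$ equals \[ \mathcal R_{\rm E-E}=\int_0^\infty\!\!\int_0^\infty \sum_{m=0}^{m_{\rm rd}-1}\sum_{k=0}^m\binom mk\frac{P_{\rm s}^k\Gamma(k+m_{\rm sd})}{\Gamma(m+1)}\cdot\frac{x^{m_{\rm rr}-1}\Gamma\!\left(m_{\rm sr},\frac{P_{\rm r}x+1}{P_{\rm s}\theta_{\rm sr}}\Psi_r\!\left(\frac{P_{\rm r}x\mathcal C_x}{P_{\rm r}x+1}\right)\right)\beta_r^m\,e^{-(\beta_r+x/\theta_{\rm rr})}}{\Gamma(m_{\rm sd})\Gamma(m_{\rm rr})\Gamma(m_{\rm sr})\theta_{\rm sd}^{m_{\rm sd}}\theta_{\rm rr}^{m_{\rm rr}}\left(P_{\rm s}\beta_r+\frac1{\theta_{\rm sd}}\right)^{k+m_{\rm sd}}}\,dx\,dr, \] where $\beta_r=\frac{\Psi_r(\mathcal C_x)}{P_{\rm r}\theta_{\rm rd}(1-\mathcal C_x^2)}$ and $\Psi_r$ depends on the integration variable $r$.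
   Context: Let $P_{\rm s}>0$, $P_{\rm r}>0$ be the source and relay transmit powers. For links $ij\in\{\mathrm{sr},\mathrm{rr},\mathrm{rd},\mathrm{sd}\}$ let $g_{ij}$ be mutually independent random channel gains, $g_{ij}$ gamma distributed with integer shape parameter $m_{ij}\ge1$ and scale $\theta_{ij}=\pi_{ij}/m_{ij}$, where $\pi_{ij}=\mathbb E[g_{ij}]>0$; i.e. $g_{ij}$ has density $x^{m_{ij}-1}e^{-x/\theta_{ij}}/(\Gamma(m_{ij})\theta_{ij}^{m_{ij}})$ for $x\ge0$. For a circularity coefficient $\mathcal C_x\in[0,1)$ define $R_{\rm sr}(P_{\rm r},\mathcal C_x)=\tfrac12\log_2\frac{(P_{\rm s}g_{\rm sr}+P_{\rm r}g_{\rm rr}+1)^2-(P_{\rm r}g_{\rm rr}\mathcal C_x)^2}{(P_{\rm r}g_{\rm rr}+1)^2-(P_{\rm r}g_{\rm rr}\mathcal C_x)^2}$ and $R_{\rm rd}(P_{\rm r},\mathcal C_x)=\tfrac12\log_2\frac{(P_{\rm r}g_{\rm rd}+P_{\rm s}g_{\rm sd}+1)^2-(P_{\rm r}g_{\rm rd}\mathcal C_x)^2}{(P_{\rm s}g_{\rm sd}+1)^2}$. For $r>0$ put $\gamma=2^{2r}-1$ and $\Psi_r(x)=\sqrt{1+\gamma(1-x^2)}-1$. $\Gamma(a,x)=\int_x^\infty t^{a-1}e^{-t}dt$ is the upper incomplete gamma function. *)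

(* Defs.v *)
From Stdlib Require Import Reals Lra Classical ClassicalEpsilon.
Open Scope R_scope.

Definition is_RInt (f : R -> R) (a b v : R) : Prop :=
  exists pr : Riemann_integrable f a b, RiemannInt pr = v.

Definition is_IntFrom (a : R) (f : R -> R) (v : R) : Prop :=
  forall eps : R, 0 < eps -> exists B : R, a <= B /\
    forall b : R, B <= b -> exists w : R, is_RInt f a b w /\ Rabs (w - v) < eps.

(** The value of int_a^oo f (unique when it exists; arbitrary otherwise). *)
Definition IntFrom (a : R) (f : R -> R) : R :=
  epsilon (inhabits 0) (fun v => is_IntFrom a f v).

(** Upper incomplete gamma Gamma(s, x) = int_x^oo t^(s-1) e^(-t) dt,
    for integer shape s >= 1. *)
Definition uigamma (s : nat) (x : R) : R :=
  IntFrom x (fun t => t ^ (s - 1) * exp (- t)).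

Definition Gammaf (s : nat) : R := uigamma s 0.

Definition gamma_pdf (m : nat) (th x : R) : R :=
  x ^ (m - 1) * exp (- x / th) / (Gammaf m * th ^ m).

Definition log2 (x : R) : R := ln x / ln 2.

(** Expectation of h(g_sr, g_rr, g_rd, g_sd) for mutually independent
    gamma-distributed gains, written as an iterated integral against
    the product density.  The outermost integral is relational. *)
Definition is_Expect4 (m_sr m_rr m_rd m_sd : nat) (t_sr t_rr t_rd t_sd : R)
    (h : R -> R -> R -> R -> R) (v : R) : Prop :=
  is_IntFrom 0 (fun a =>
    IntFrom 0 (fun b =>
      IntFrom 0 (fun c =>
        IntFrom 0 (fun d =>
          h a b c d * gamma_pdf m_sr t_sr a * gamma_pdf m_rr t_rr b
                    * gamma_pdf m_rd t_rd c * gamma_pdf m_sd t_sd d)))) v.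

Definition R_sr (Ps Pr Cx g_sr g_rr : R) : R :=
  / 2 * log2 (((Ps * g_sr + Pr * g_rr + 1) ^ 2 - (Pr * g_rr * Cx) ^ 2)
              / ((Pr * g_rr + 1) ^ 2 - (Pr * g_rr * Cx) ^ 2)).

Definition R_rd (Ps Pr Cx g_rd g_sd : R) : R :=
  / 2 * log2 (((Pr * g_rd + Ps * g_sd + 1) ^ 2 - (Pr * g_rd * Cx) ^ 2)
              / (Ps * g_sd + 1) ^ 2).

Definition gam (r : R) : R := Rpower 2 (2 * r) - 1.
Definition Psi (r x : R) : R := sqrt (1 + gam r * (1 - x ^ 2)) - 1.

Definition beta (Pr t_rd Cx r : R) : R :=
  Psi r Cx / (Pr * t_rd * (1 - Cx ^ 2)).

Definition RHS_integrand (Ps Pr Cx : R) (m_sr m_rr m_rd m_sd : nat)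
    (t_sr t_rr t_rd t_sd : R) (x r : R) : R :=
  let b := beta Pr t_rd Cx r in
  sum_f_R0 (fun m =>
    sum_f_R0 (fun k =>
      Binomial.C m k * Ps ^ k * Gammaf (k + m_sd) / Gammaf (m + 1)
      * (x ^ (m_rr - 1)
         * uigamma m_sr ((Pr * x + 1) / (Ps * t_sr)
                          * Psi r (Pr * x * Cx / (Pr * x + 1)))
         * b ^ m * exp (- (b + x / t_rr)))
      / (Gammaf m_sd * Gammaf m_rr * Gammaf m_sr * t_sd ^ m_sd * t_rr ^ m_rr
         * (Ps * b + / t_sd) ^ (k + m_sd))) m) (m_rd - 1).

(* Main.v *)
Require Import Defs.
From Stdlib Require Import Reals Factorial Lra Lia.
From Stdlib Require Import ClassicalEpsilon FunctionalExtensionality PropExtensionality.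
From Coquelicot Require Import Coquelicot.
Open Scope R_scope.

(* The expectation of min(R_sr, R_rd) is the integral over r of
   P(R_sr > r) P(R_rd > r).  Each rate is increasing in its first gain, so {R_sr > r} and
   {R_rd > r} are gain thresholds, and the layer-cake identity becomes an integration by
   parts in that gain, with no discontinuous indicator: it turns the density into the tail
   function evaluated at the threshold.  What remains is to exchange integrals of continuous
   functions on the quadrant dominated by K exp(-l x - m y), which reduces to Fubini on
   rectangles with exponentially small errors.  The domination comes from
   R_sr <= log2(1 + Ps g_sr) and R_rd <= log2(1 + Pr g_rd).  The closed form follows from
   Gamma(n+1, x) = n! e^(-x) sum_(j <= n) x^j / j! and the binomial expansion of
   (Ps g_sd + 1)^m. *)

(** * Improper integrals *)

(** The minimum is treated one pair of gains at a time. With the first rate frozen at a value [u],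
    averaging over the second pair gives E[min(u, R_rd)] = int_0^u S, where S(r) = P(R_rd > r). Then
    [S] becomes a bounded continuous weight for the first pair: E[int_0^(R_sr) S] = int_0^oo P(R_sr
    > r) S(r) dr. This is why the layer-cake identity carries a weight, and why the truncated
    version with [Rmin u] is proved separately. The obstacle is that [IntFrom] is a choice,
    arbitrary on divergent integrals, so linearity and exchange of integrals are available only
    together with convergence. Results are therefore passed on in the relational form [is_IntFrom],
    and dominated convergence is replaced by explicit errors: two candidate values of an integral
    agree as soon as their difference is bounded by C exp(-l b) for every b >= 0. *)

Lemma is_IntFrom_lim (a : R) (f : R -> R) (v : R) :
  is_IntFrom a f v <->
  (forall b, a <= b -> ex_RInt f a b) /\ is_lim (RInt f a) p_infty v.
Proof.
split.
- intros H; split.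
  + intros b Hb. destruct (H 1 Rlt_0_1) as [B [HB HB']].
    destruct (HB' (Rmax b B) (Rmax_r _ _)) as [w [[pr _] _]].
    apply (ex_RInt_Chasles_1 f a b (Rmax b B)).
    * split; [exact Hb | apply Rmax_l].
    * exact (ex_RInt_Reals_1 _ _ _ pr).
  + apply is_lim_spec. intros eps.
    destruct (H eps (cond_pos eps)) as [B [HB HB']].
    exists B. intros x Hx.
    destruct (HB' x (Rlt_le _ _ Hx)) as [w [[pr Hw] Hlt]].
    rewrite (RInt_Reals _ _ _ pr), Hw. exact Hlt.
- intros [Hex Hlim] eps Heps.
  apply is_lim_spec in Hlim. destruct (Hlim (mkposreal eps Heps)) as [M HM].
  (* A neighbourhood of [p_infty] only covers M < x, whereas [is_IntFrom] includes b = B; hence M +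
     1. *)
  exists (Rmax a (M + 1)). split; [apply Rmax_l |].
  intros b Hb. exists (RInt f a b). split.
  + assert (Hab : a <= b) by (eapply Rle_trans; [apply Rmax_l | exact Hb]).
    exists (ex_RInt_Reals_0 _ _ _ (Hex b Hab)). symmetry; apply RInt_Reals.
  + apply HM. assert (M + 1 <= b) by (eapply Rle_trans; [apply Rmax_r | exact Hb]). lra.
Qed.

Lemma IntFrom_unique (a : R) (f : R -> R) (v : R) :
  is_IntFrom a f v -> IntFrom a f = v.
Proof.
intros H. assert (H' : is_IntFrom a f (IntFrom a f)).
{ unfold IntFrom. apply epsilon_spec. exists v; exact H. }
apply is_IntFrom_lim in H; apply is_IntFrom_lim in H'.
destruct H as [_ H]; destruct H' as [_ H'].
apply is_lim_unique in H; apply is_lim_unique in H'.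
rewrite H in H'. now injection H'.
Qed.

Lemma is_IntFrom_ext (a : R) (f g : R -> R) (v : R) :
  (forall x, a <= x -> f x = g x) -> is_IntFrom a f v -> is_IntFrom a g v.
Proof.
intros Hfg H. apply is_IntFrom_lim in H; apply is_IntFrom_lim.
destruct H as [H1 H2]; split.
- intros b Hb. apply (ex_RInt_ext f); [| now apply H1].
  intros x Hx. rewrite Rmin_left in Hx by exact Hb. apply Hfg; lra.
- apply is_lim_ext_loc with (2 := H2). exists a. intros b Hb.
  apply RInt_ext. intros x Hx. rewrite Rmin_left in Hx by lra. apply Hfg; lra.
Qed.

Lemma IntFrom_ext (a : R) (f g : R -> R) :
  (forall x, a <= x -> f x = g x) -> IntFrom a f = IntFrom a g.
Proof.
intros H. destruct (excluded_middle_informative (exists v, is_IntFrom a f v)) as [[v Hv] | Hn].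
- rewrite (IntFrom_unique _ _ _ Hv). symmetry. apply IntFrom_unique.
  now apply is_IntFrom_ext with f.
(* With no convergent value, both sides are [epsilon] applied to the same predicate up to
   extensionality, so even the arbitrary defaults agree. *)
- unfold IntFrom. f_equal.
  apply functional_extensionality. intros v. apply propositional_extensionality.
  split; apply is_IntFrom_ext; intros x Hx; [| symmetry]; now apply H.
Qed.

Lemma is_IntFrom_plus (a : R) (f g : R -> R) (v w : R) :
  is_IntFrom a f v -> is_IntFrom a g w -> is_IntFrom a (fun x => f x + g x) (v + w).
Proof.
intros Hf Hg. apply is_IntFrom_lim in Hf; apply is_IntFrom_lim in Hg.
destruct Hf as [F1 F2]; destruct Hg as [G1 G2].
apply is_IntFrom_lim; split.
- intros b Hb. apply @ex_RInt_plus; auto.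
- apply is_lim_ext_loc with (fun b => RInt f a b + RInt g a b).
  + exists a. intros b Hb. symmetry. apply (RInt_plus f g a b); [apply F1 | apply G1]; lra.
  + now apply (is_lim_plus' (RInt f a) (RInt g a)).
Qed.

Lemma is_IntFrom_scal (a k : R) (f : R -> R) (v : R) :
  is_IntFrom a f v -> is_IntFrom a (fun x => k * f x) (k * v).
Proof.
intros Hf. apply is_IntFrom_lim in Hf. destruct Hf as [F1 F2].
apply is_IntFrom_lim; split.
- intros b Hb. apply (ex_RInt_scal f); auto.
- apply is_lim_ext_loc with (fun b => k * RInt f a b).
  + exists a. intros b Hb. symmetry. apply (RInt_scal f a b); apply F1; lra.
  + now apply (is_lim_scal_l (RInt f a) k p_infty v).
Qed.

Lemma is_IntFrom_sum (a : R) (f : nat -> R -> R) (v : nat -> R) (n : nat) :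
  (forall i, (i <= n)%nat -> is_IntFrom a (f i) (v i)) ->
  is_IntFrom a (fun x => sum_f_R0 (fun i => f i x) n) (sum_f_R0 v n).
Proof.
induction n as [| n IH]; intros H; simpl.
- apply is_IntFrom_ext with (f 0%nat); auto.
- apply is_IntFrom_plus; auto.
Qed.

Lemma is_IntFrom_antiderivative (a : R) (f F : R -> R) (l : R) :
  (forall x, a <= x -> is_derive F x (f x)) -> (forall x, a <= x -> continuous f x) ->
  is_lim F p_infty l -> is_IntFrom a f (l - F a).
Proof.
intros HF Hf HL.
assert (HI : forall b, a <= b -> is_RInt f a b (F b - F a)).
{ intros b Hb. apply (is_RInt_derive F f).
  - intros x Hx. rewrite Rmin_left in Hx by exact Hb. apply HF; lra.
  - intros x Hx. rewrite Rmin_left in Hx by exact Hb. apply Hf; lra. }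
apply is_IntFrom_lim; split.
- intros b Hb. exists (F b - F a). now apply HI.
- apply is_lim_ext_loc with (fun b => F b - F a).
  + exists a. intros b Hb. symmetry. apply is_RInt_unique, HI; lra.
  + apply (is_lim_minus' F (fun _ => F a)); [exact HL | apply is_lim_const].
Qed.

Lemma is_lim_exp_decay (K l : R) : 0 < l -> is_lim (fun x => K * exp (- l * x)) p_infty 0.
Proof.
intros Hl. replace (Finite 0) with (Rbar_mult K (Finite 0)) by (simpl; f_equal; ring).
apply (is_lim_scal_l (fun x => exp (- l * x)) K p_infty 0).
apply (is_lim_comp exp (fun x => - l * x) p_infty (Finite 0) m_infty).
- apply is_lim_exp_m.
- apply is_lim_spec. intros M. exists (- M / l). intros x Hx.
  assert (l * (- M / l) < l * x) by (apply Rmult_lt_compat_l; lra).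
  replace (l * (- M / l)) with (- M) in H by (field; lra). lra.
- exists 0. intros x Hx; discriminate.
Qed.

Lemma is_lim_exp_squeeze (f : R -> R) (K l : R) :
  0 < l -> (forall x, 0 <= x -> Rabs (f x) <= K * exp (- l * x)) -> is_lim f p_infty 0.
Proof.
intros Hl Hf.
apply is_lim_le_le_loc with (f := fun x => (- K) * exp (- l * x)) (g := fun x => K * exp (- l * x)).
- exists 0. intros x Hx. specialize (Hf x (Rlt_le _ _ Hx)).
  apply Rabs_le_between in Hf. lra.
- now apply is_lim_exp_decay.
- now apply is_lim_exp_decay.
Qed.

Lemma exp_decay_le_0 (v K l : R) :
  0 < l -> (forall x, 0 <= x -> Rabs v <= K * exp (- l * x)) -> v = 0.
Proof.
intros Hl H. pose proof (is_lim_exp_squeeze (fun _ => v) K l Hl H) as H1.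
pose proof (is_lim_const v p_infty) as H2.
apply is_lim_unique in H1; apply is_lim_unique in H2. rewrite H1 in H2. now injection H2.
Qed.

(* Continuity on the closed half-line and quadrant, phrased through the retraction [Rmax 0]
   because Coquelicot's criteria ask for two-sided continuity, also at the boundary. *)
Definition continuous_halfline (f : R -> R) : Prop :=
  forall x, continuous (fun x => f (Rmax 0 x)) x.

Definition continuous_quadrant (f : R -> R -> R) : Prop :=
  forall z : R * R, continuous (fun z => f (Rmax 0 (fst z)) (Rmax 0 (snd z))) z.

Lemma continuous_Rmax_0 (x : R) : continuous (Rmax 0) x.
Proof.
apply continuous_ext with (fun x => / 2 * (x + Rabs x)).
- intros y. unfold Rabs, Rmax. destruct (Rcase_abs y), (Rle_dec 0 y); simpl; lra.
- apply (continuous_scal_r (/ 2) (fun x => x + Rabs x)).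
  apply (continuous_plus (fun x => x) Rabs); [apply continuous_id | apply continuous_Rabs].
Qed.

Lemma halfline_ex_RInt (f : R -> R) (a b : R) :
  continuous_halfline f -> 0 <= a -> 0 <= b -> ex_RInt f a b.
Proof.
intros Hf Ha Hb. apply ex_RInt_ext with (fun x => f (Rmax 0 x)).
- intros x Hx. rewrite Rmax_right; [reflexivity |].
  assert (0 <= Rmin a b) by (now apply Rmin_glb). lra.
- apply (ex_RInt_continuous (V := R_CompleteNormedModule)). intros; apply Hf.
Qed.

Lemma is_RInt_exp_decay (K l a b : R) :
  0 < l -> is_RInt (fun x => K * exp (- l * x)) a b (K / l * exp (- l * a) - K / l * exp (- l * b)).
Proof.
intros Hl.
replace (K / l * exp (- l * a) - K / l * exp (- l * b))
  with ((- (K / l) * exp (- l * b)) - (- (K / l) * exp (- l * a))) by ring.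
apply (is_RInt_derive (fun x => - (K / l) * exp (- l * x))).
- intros x _. auto_derive; [exact I | field; lra].
- intros x _. apply (ex_derive_continuous (fun x => K * exp (- l * x))). auto_derive. exact I.
Qed.

Lemma RInt_Chasles_R (f : R -> R) (a b c : R) :
  ex_RInt f a b -> ex_RInt f b c -> RInt f a b + RInt f b c = RInt f a c.
Proof. exact (RInt_Chasles f a b c). Qed.

Lemma RInt_exp_dominated (f : R -> R) (K l a b : R) :
  0 < l -> 0 <= a <= b -> ex_RInt f a b ->
  (forall x, 0 <= x -> Rabs (f x) <= K * exp (- l * x)) ->
  Rabs (RInt f a b) <= K / l * exp (- l * a).
Proof.
intros Hl Hab Hex Hf.
assert (HK : 0 <= K).
{ specialize (Hf 0 (Rle_refl 0)). rewrite Rmult_0_r, exp_0 in Hf.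
  pose proof (Rabs_pos (f 0)). lra. }
assert (H : Rabs (RInt f a b) <= K / l * exp (- l * a) - K / l * exp (- l * b)).
{ apply (norm_RInt_le f (fun x => K * exp (- l * x)) a b).
  - lra.
  - intros x Hx. apply Hf; lra.
  - now apply (RInt_correct f a b).
  - now apply is_RInt_exp_decay. }
assert (0 <= K / l * exp (- l * b)).
{ apply Rmult_le_pos; [apply Rdiv_le_0_compat; lra | apply Rlt_le, exp_pos]. }
lra.
Qed.

(** Partial integrals differ by at most the tail K/l exp(-l u) of the majorant, so they are Cauchy;
    letting the larger endpoint tend to infinity in the same estimate gives the second clause. That
    error depends on [f] only through [K] and [l], which makes it uniform in any parameter of
    [f]. *)
Lemma is_IntFrom_dominated (f : R -> R) (K l : R) :
  continuous_halfline f -> 0 < l -> (forall x, 0 <= x -> Rabs (f x) <= K * exp (- l * x)) ->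
  is_IntFrom 0 f (IntFrom 0 f) /\
  (forall b, 0 <= b -> Rabs (IntFrom 0 f - RInt f 0 b) <= K / l * exp (- l * b)).
Proof.
intros Hc Hl Hf.
assert (Hdiff : forall u v, 0 <= u <= v ->
  Rabs (RInt f 0 v - RInt f 0 u) <= K / l * exp (- l * u)).
{ intros u v Huv.
  rewrite <- (RInt_Chasles_R f 0 u v) by (apply halfline_ex_RInt; auto; lra).
  rewrite Rplus_minus_l.
  apply RInt_exp_dominated; auto. apply halfline_ex_RInt; auto; lra. }
assert (Hlim : exists v : R, is_lim (RInt f 0) p_infty v).
{ destruct (proj1 (filterlim_locally_cauchy (U := R_CompleteSpace) (F := Rbar_locally' p_infty) (RInt f 0))) as [y Hy].
  - intros eps.
    pose proof (is_lim_exp_decay (K / l) l Hl) as HD. apply is_lim_spec in HD.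
    destruct (HD eps) as [M HM].
    exists (fun x => Rmax 0 M < x). split; [exists (Rmax 0 M); auto |].
    assert (W : forall u v, Rmax 0 M < u -> u <= v -> Rabs (RInt f 0 v - RInt f 0 u) < eps).
    { intros u v Hu Huv. pose proof (Rmax_l 0 M). pose proof (Rmax_r 0 M).
      eapply Rle_lt_trans; [apply Hdiff; lra |].
      eapply Rle_lt_trans; [| apply (HM u); lra]. rewrite Rminus_0_r. apply Rle_abs. }
    intros u v Hu Hv. unfold ball; simpl; unfold AbsRing_ball; simpl.
    destruct (Rle_dec u v) as [h | h].
    + apply W; auto.
    + change (Rabs (RInt f 0 v - RInt f 0 u) < eps). rewrite Rabs_minus_sym. apply W; lra.
  - exists y. exact Hy. }
destruct Hlim as [v Hv].
assert (Hi : is_IntFrom 0 f v).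
{ apply is_IntFrom_lim; split; [| exact Hv]. intros b Hb; apply halfline_ex_RInt; auto; lra. }
rewrite (IntFrom_unique _ _ _ Hi). split; [exact Hi |].
intros b Hb.
assert (H : is_lim (fun x => Rabs (RInt f 0 x - RInt f 0 b)) p_infty (Rabs (v - RInt f 0 b))).
{ apply (is_lim_comp_continuous (fun x => RInt f 0 x - RInt f 0 b) Rabs p_infty (v - RInt f 0 b)).
  - apply (is_lim_minus' (RInt f 0) (fun _ => RInt f 0 b)); [exact Hv | apply is_lim_const].
  - apply continuous_Rabs. }
apply (is_lim_le_loc (fun x => Rabs (RInt f 0 x - RInt f 0 b)) (fun _ => K / l * exp (- l * b)) p_infty (Rabs (v - RInt f 0 b))
         (K / l * exp (- l * b))); [| exact H | apply is_lim_const].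
exists b. intros x Hx. apply Hdiff; lra.
Qed.

(** * Fubini on the quadrant *)

Lemma continuity_2d_pt_section (F : R -> R -> R) (u v : R) :
  continuity_2d_pt F u v -> continuous (F u) v.
Proof.
intros HF. apply continuity_pt_filterlim.
intros eps Heps. destruct (HF (mkposreal eps Heps)) as [d Hd].
exists d. split; [apply cond_pos |]. intros y [_ Hy]. apply Hd; [| exact Hy].
rewrite Rminus_diag, Rabs_R0. apply cond_pos.
Qed.

Lemma continuity_2d_pt_swap (F : R -> R -> R) (u v : R) :
  continuity_2d_pt F v u -> continuity_2d_pt (fun x y => F y x) u v.
Proof. intros HF eps. destruct (HF eps) as [d Hd]. exists d. intros x y Hx Hy; auto. Qed.

Lemma continuous_RInt_param (F : R -> R -> R) (a b x : R) :
  a <= b -> (forall x y, continuity_2d_pt F x y) ->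
  continuous (fun x => RInt (F x) a b) x.
Proof.
intros Hab HF.
assert (Hs : forall u v, continuous (F u) v).
{ intros u v. now apply continuity_2d_pt_section. }
assert (Hex : forall u, ex_RInt (F u) a b).
{ intros u. apply (ex_RInt_continuous (V := R_CompleteNormedModule)). intros; apply Hs. }
apply continuity_pt_filterlim. intros eps Heps.
(* The [+ 1] keeps the denominator positive when a = b. *)
assert (He : 0 < eps / (b - a + 1)) by (apply Rdiv_lt_0_compat; lra).
destruct (uniform_continuity_2d_1d' F a b x (fun y _ => HF x y) (mkposreal _ He)) as [d Hd].
exists d. split; [apply cond_pos |]. intros u [_ Hu]. simpl in *; unfold Rdist in *.
apply Rabs_lt_between' in Hu.
change (Rabs (minus (RInt (F u) a b) (RInt (F x) a b)) < eps).
rewrite <- (RInt_minus (F u) (F x) a b) by auto.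
eapply Rle_lt_trans.
- apply (abs_RInt_le_const (fun t => minus (F u t) (F x t)) a b (eps / (b - a + 1)) Hab).
  + apply @ex_RInt_minus; auto.
  + intros t Ht. apply Rlt_le. pose proof (cond_pos d). apply Hd; try lra.
    rewrite Rminus_diag, Rabs_R0. lra.
- apply Rmult_lt_reg_r with (b - a + 1); [lra |]. field_simplify; [| lra]. nra.
Qed.

(** As functions of the upper bound [t] of the x-range, both iterated integrals vanish at 0 and have
    derivative [RInt (F t) 0 B]: one by the fundamental theorem of calculus, the other by
    differentiation under the integral sign. *)
Lemma RInt_fubini_continuous (F : R -> R -> R) (A B : R) :
  0 <= A -> 0 <= B -> (forall x y, continuity_2d_pt F x y) ->
  RInt (fun x => RInt (F x) 0 B) 0 A = RInt (fun y => RInt (fun x => F x y) 0 A) 0 B.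
Proof.
intros HA HB HF.
assert (Hs : forall v u, continuous (fun u => F u v) u).
{ intros v u. apply (continuity_2d_pt_section (fun y x => F x y)). now apply continuity_2d_pt_swap. }
assert (Hex : forall v a b, ex_RInt (fun u => F u v) a b).
{ intros v a b. apply (ex_RInt_continuous (V := R_CompleteNormedModule)). intros; apply Hs. }
assert (HF' : forall x y, continuity_2d_pt (fun x y => F y x) x y).
{ intros x y. now apply continuity_2d_pt_swap. }
assert (HD : forall y t, is_derive (fun z => RInt (fun x => F x y) 0 z) t (F t y)).
{ intros y t. apply (is_derive_RInt (fun x => F x y) _ 0 t).
  - apply filter_forall. intros z. apply (RInt_correct (fun x => F x y)), Hex.
  - apply Hs. }
pose (Phi := fun t => RInt (fun x => RInt (F x) 0 B) 0 t
                      - RInt (fun y => RInt (fun x => F x y) 0 t) 0 B).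
assert (HPhi : forall t, 0 <= t -> is_derive Phi t 0).
{ intros t Ht.
  replace 0 with (RInt (F t) 0 B - RInt (F t) 0 B) by ring.
  apply (is_derive_minus (fun t => RInt (fun x => RInt (F x) 0 B) 0 t)
           (fun t => RInt (fun y => RInt (fun x => F x y) 0 t) 0 B)).
  - apply (is_derive_RInt (fun x => RInt (F x) 0 B) _ 0 t).
    + apply filter_forall. intros z. apply (RInt_correct (fun x => RInt (F x) 0 B)).
      apply (ex_RInt_continuous (V := R_CompleteNormedModule)).
      intros; now apply continuous_RInt_param.
    + now apply continuous_RInt_param.
  - replace (RInt (F t) 0 B)
      with (RInt (fun y => Derive (fun u => RInt (fun x => F x y) 0 u) t) 0 B).
    2: { apply RInt_ext. intros y _. apply is_derive_unique, HD. }
    apply (is_derive_RInt_param (fun u y => RInt (fun x => F x y) 0 u)).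
    + apply filter_forall. intros z y _. exists (F z y). apply HD.
    + intros y _. apply continuity_2d_pt_ext with (2 := HF t y).
      intros u v. symmetry. apply is_derive_unique, HD.
    + exists posreal_one. intros z _.
      apply (ex_RInt_continuous (V := R_CompleteNormedModule)). intros y _.
      (* A neighbourhood of [t = 0] contains negative [z], for which the inner integral must be
         reversed before the parameter lemma, stated for ordered bounds, applies. *)
      destruct (Rle_dec 0 z) as [Hz | Hz].
      * now apply (continuous_RInt_param (fun y x => F x y)).
      * apply continuous_ext with (fun y => - RInt (fun x => F x y) z 0).
        -- intros w. apply (opp_RInt_swap (fun x => F x w)), Hex.
        -- apply (continuous_opp (fun y => RInt (fun x => F x y) z 0)).
           apply (continuous_RInt_param (fun y x => F x y)); [lra | exact HF']. }
assert (H0 : Phi 0 = 0).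
{ unfold Phi. rewrite RInt_point.
  rewrite (RInt_ext _ (fun _ => 0)).
  - rewrite RInt_const. change zero with 0. unfold scal; simpl; unfold mult; simpl. ring.
  - intros y _. exact (RInt_point 0 (fun x => F x y)). }
assert (HPA : Phi A = 0).
{ destruct (Rle_lt_or_eq_dec 0 A HA) as [h | h]; [| now rewrite <- h].
  rewrite <- H0. symmetry. apply eq_is_derive; [| exact h].
  intros t Ht. apply HPhi; lra. }
unfold Phi in HPA. lra.
Qed.

Lemma continuity_2d_pt_clamp (f : R -> R -> R) :
  continuous_quadrant f -> forall x y, continuity_2d_pt (fun x y => f (Rmax 0 x) (Rmax 0 y)) x y.
Proof. intros Hf x y. apply continuity_2d_pt_filterlim. apply (Hf (x, y)). Qed.

Lemma quadrant_swap (f : R -> R -> R) : continuous_quadrant f -> continuous_quadrant (fun y x => f x y).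
Proof.
intros Hf [x y]. 
apply (continuous_comp_2 snd fst (fun x y => f (Rmax 0 x) (Rmax 0 y))).
- apply continuous_snd.
- apply continuous_fst.
- apply (Hf (y, x)).
Qed.

Lemma quadrant_section (f : R -> R -> R) (x : R) : continuous_quadrant f -> 0 <= x -> continuous_halfline (f x).
Proof.
intros Hf Hx y.
apply continuous_ext with (fun y => f (Rmax 0 x) (Rmax 0 y)).
{ intros w. now rewrite (Rmax_right 0 x). }
apply (continuous_comp_2 (fun _ => x) (fun y => y) (fun u y => f (Rmax 0 u) (Rmax 0 y))).
- apply continuous_const.
- apply continuous_id.
- apply (Hf (x, y)).
Qed.

Lemma RInt_clamp (f : R -> R) (a b : R) :
  0 <= a -> 0 <= b -> RInt (fun x => f (Rmax 0 x)) a b = RInt f a b.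
Proof.
intros Ha Hb. apply RInt_ext. intros x Hx.
assert (0 <= Rmin a b) by (now apply Rmin_glb). rewrite Rmax_right; [reflexivity | lra].
Qed.

Lemma quadrant_RInt (f : R -> R -> R) (B : R) :
  continuous_quadrant f -> 0 <= B -> continuous_halfline (fun x => RInt (f x) 0 B).
Proof.
intros Hf HB x.
apply continuous_ext with (fun x => RInt (fun y => f (Rmax 0 x) (Rmax 0 y)) 0 B).
- intros w. apply RInt_clamp; lra.
- apply (continuous_RInt_param (fun x y => f (Rmax 0 x) (Rmax 0 y))); [exact HB |].
  now apply continuity_2d_pt_clamp.
Qed.

Lemma RInt_fubini (f : R -> R -> R) (A B : R) :
  continuous_quadrant f -> 0 <= A -> 0 <= B ->
  RInt (fun x => RInt (f x) 0 B) 0 A = RInt (fun y => RInt (fun x => f x y) 0 A) 0 B.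
Proof.
intros Hf HA HB.
rewrite <- (RInt_clamp (fun x => RInt (f x) 0 B)) by lra.
rewrite <- (RInt_clamp (fun y => RInt (fun x => f x y) 0 A)) by lra.
rewrite (RInt_ext _ (fun x => RInt (fun y => f (Rmax 0 x) (Rmax 0 y)) 0 B))
  by (intros x _; symmetry; apply RInt_clamp; lra).
rewrite (RInt_ext (fun y => RInt (fun x => f x (Rmax 0 y)) 0 A)
           (fun y => RInt (fun x => f (Rmax 0 x) (Rmax 0 y)) 0 A))
  by (intros y _; symmetry; apply (RInt_clamp (fun x => f x (Rmax 0 y))); lra).
apply (RInt_fubini_continuous (fun x y => f (Rmax 0 x) (Rmax 0 y))); auto.
now apply continuity_2d_pt_clamp.
Qed.

(** The usual eps/3 argument; the error bound is required at every [y], not only at [x]. *)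
Lemma continuous_uniform_limit (g : R -> R) (h : R -> R -> R) (K l x : R) :
  0 < l -> (forall b, 0 <= b -> continuous (h b) x) ->
  (forall b y, 0 <= b -> Rabs (g y - h b y) <= K * exp (- l * b)) -> continuous g x.
Proof.
intros Hl Hh Hgh. apply continuity_pt_filterlim. intros eps Heps.
pose proof (is_lim_exp_decay K l Hl) as HD. apply is_lim_spec in HD.
assert (He : 0 < eps / 3) by lra.
destruct (HD (mkposreal _ He)) as [M HM].
pose (b := Rmax 0 M + 1).
pose proof (Rmax_l 0 M). pose proof (Rmax_r 0 M).
assert (Hb0 : 0 <= b) by (unfold b; lra).
assert (Hb : K * exp (- l * b) < eps / 3).
{ eapply Rle_lt_trans; [| apply (HM b); unfold b; lra]. rewrite Rminus_0_r. apply Rle_abs. }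
pose proof (proj2 (continuity_pt_filterlim _ _) (Hh b Hb0)) as Hc.
destruct (Hc _ He) as [d [Hd Hd']]. exists d. split; [exact Hd |].
intros y Hy. specialize (Hd' y Hy). simpl in *; unfold Rdist in *.
pose proof (Hgh b x Hb0). pose proof (Hgh b y Hb0).
replace (g y - g x) with ((g y - h b y) + (h b y - h b x) - (g x - h b x)) by ring.
unfold Rabs in *; repeat destruct Rcase_abs; lra.
Qed.

(** The integrals over [0, b] are continuous in [x] and converge uniformly, because the majorant
    does not depend on [x]. *)
Lemma quadrant_IntFrom (f : R -> R -> R) (K l : R) :
  continuous_quadrant f -> 0 < l -> (forall x y, 0 <= x -> 0 <= y -> Rabs (f x y) <= K * exp (- l * y)) ->
  continuous_halfline (fun x => IntFrom 0 (f x)).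
Proof.
intros Hf Hl Hb x.
apply (continuous_uniform_limit _ (fun b x => RInt (f (Rmax 0 x)) 0 b) (K / l) l x Hl).
- intros b Hb0. now apply (quadrant_RInt f b).
- intros b y Hb0. pose proof (Rmax_l 0 y).
  apply (is_IntFrom_dominated (f (Rmax 0 y))); auto. now apply quadrant_section.
Qed.

(** Fubini on the rectangle [0, A] x [0, b], then b to infinity: the strip left out has width [A],
    and each of its sections contributes at most K/l exp(-l b). *)
Lemma IntFrom_fubini_RInt (f : R -> R -> R) (K l A : R) :
  continuous_quadrant f -> 0 < l -> 0 <= A ->
  (forall x y, 0 <= x -> 0 <= y -> Rabs (f x y) <= K * exp (- l * y)) ->
  is_IntFrom 0 (fun y => RInt (fun x => f x y) 0 A) (RInt (fun x => IntFrom 0 (f x)) 0 A).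
Proof.
intros Hf Hl HA Hb.
assert (Hc : continuous_halfline (fun x => IntFrom 0 (f x))) by (now apply quadrant_IntFrom with K l).
apply is_IntFrom_lim; split.
- intros b Hb0. apply halfline_ex_RInt; try lra.
  apply (quadrant_RInt (fun y x => f x y)); [now apply quadrant_swap | exact HA].
- replace (RInt (fun x => IntFrom 0 (f x)) 0 A)
    with (0 + RInt (fun x => IntFrom 0 (f x)) 0 A) by ring.
  apply is_lim_ext_loc with (fun b => (RInt (fun y => RInt (fun x => f x y) 0 A) 0 b
     - RInt (fun x => IntFrom 0 (f x)) 0 A) + RInt (fun x => IntFrom 0 (f x)) 0 A).
  { exists 0. intros b _. lra. }
  apply (is_lim_plus' _ (fun _ => RInt (fun x => IntFrom 0 (f x)) 0 A)); [| apply is_lim_const].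
  apply is_lim_exp_squeeze with (A * (K / l)) l; [exact Hl |]. intros b Hb0.
  rewrite <- RInt_fubini by auto.
  rewrite Rabs_minus_sym.
  change (Rabs (minus (RInt (fun x => IntFrom 0 (f x)) 0 A)
                      (RInt (fun x => RInt (f x) 0 b) 0 A)) <= A * (K / l) * exp (- l * b)).
  assert (Hc2 : continuous_halfline (fun x => RInt (f x) 0 b)) by (now apply quadrant_RInt).
  rewrite <- (RInt_minus (fun x => IntFrom 0 (f x))) by (apply halfline_ex_RInt; auto; lra).
  replace (A * (K / l) * exp (- l * b)) with ((A - 0) * (K / l * exp (- l * b))) by ring.
  apply (abs_RInt_le_const (fun x => minus (IntFrom 0 (f x)) (RInt (f x) 0 b))); [lra | |].
  + apply @ex_RInt_minus; apply halfline_ex_RInt; auto; lra.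
  + intros x Hx. apply (is_IntFrom_dominated (f x)); auto.
    * apply quadrant_section; auto; lra.
    * intros y Hy. apply Hb; lra.
Qed.

Lemma IntFrom_abs_le (f : R -> R) (K l : R) :
  continuous_halfline f -> 0 < l -> (forall x, 0 <= x -> Rabs (f x) <= K * exp (- l * x)) ->
  Rabs (IntFrom 0 f) <= K / l.
Proof.
intros Hf Hl Hb. destruct (is_IntFrom_dominated f K l Hf Hl Hb) as [_ H].
specialize (H 0 (Rle_refl 0)). rewrite RInt_point, Rmult_0_r, exp_0 in H.
change zero with 0 in H. rewrite Rminus_0_r in H. lra.
Qed.

Definition exp_dominated2 (f : R -> R -> R) : Prop :=
  exists K l m, 0 < l /\ 0 < m /\
    forall x y, 0 <= x -> 0 <= y -> Rabs (f x y) <= K * exp (- l * x) * exp (- m * y).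

(** Both orders are compared with the integral over the strip x <= A. In the first order the
    discrepancy is a tail in [x]. In the second, [IntFrom_fubini_RInt] writes the strip integral as
    an integral over [y], so the discrepancy is the y-integral of the x-tails. Each is at most K/(l
    m) exp(-l A), whence the factor 2 below. *)
Lemma IntFrom_fubini (f : R -> R -> R) :
  continuous_quadrant f -> exp_dominated2 f ->
  is_IntFrom 0 (fun x => IntFrom 0 (f x)) (IntFrom 0 (fun x => IntFrom 0 (f x))) /\
  is_IntFrom 0 (fun y => IntFrom 0 (fun x => f x y)) (IntFrom 0 (fun x => IntFrom 0 (f x))).
Proof.
intros Hf [K [l [m [Hl [Hm Hb]]]]].
assert (HK : 0 <= K).
{ specialize (Hb 0 0 (Rle_refl 0) (Rle_refl 0)). rewrite !Rmult_0_r, exp_0 in Hb.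
  pose proof (Rabs_pos (f 0 0)). lra. }
assert (Hle : forall k x, 0 < k -> 0 <= x -> 0 < exp (- k * x) <= 1).
{ intros k x Hk Hx. split; [apply exp_pos |]. rewrite <- exp_0.
  destruct (Rle_lt_or_eq_dec 0 x Hx) as [h | h].
  - apply Rlt_le, exp_increasing. nra.
  - rewrite <- h, Rmult_0_r. lra. }
assert (Hby : forall x y, 0 <= x -> 0 <= y -> Rabs (f x y) <= K * exp (- m * y)).
{ intros x y Hx Hy. eapply Rle_trans; [apply Hb; auto |].
  destruct (Hle l x Hl Hx). destruct (Hle m y Hm Hy).
  apply Rmult_le_compat_r; [lra |]. nra. }
assert (Hbx : forall x y, 0 <= x -> 0 <= y -> Rabs (f x y) <= K * exp (- l * x)).
{ intros x y Hx Hy. eapply Rle_trans; [apply Hb; auto |].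
  destruct (Hle l x Hl Hx). destruct (Hle m y Hm Hy).
  rewrite <- (Rmult_1_r (K * exp (- l * x))) at 2.
  apply Rmult_le_compat_l; [apply Rmult_le_pos |]; lra. }
pose proof (quadrant_swap f Hf) as Hf'.
assert (HX : is_IntFrom 0 (fun x => IntFrom 0 (f x)) (IntFrom 0 (fun x => IntFrom 0 (f x))) /\
  (forall b, 0 <= b -> Rabs (IntFrom 0 (fun x => IntFrom 0 (f x))
     - RInt (fun x => IntFrom 0 (f x)) 0 b) <= (K / m) / l * exp (- l * b))).
{ apply is_IntFrom_dominated; auto.
  - now apply quadrant_IntFrom with K m.
  - intros x Hx. replace (K / m * exp (- l * x)) with (K * exp (- l * x) / m) by (field; lra).
    apply IntFrom_abs_le; auto. now apply quadrant_section. }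
assert (HYc : continuous_halfline (fun y => IntFrom 0 (fun x => f x y))).
{ apply (quadrant_IntFrom (fun y x => f x y) K l); auto. }
assert (HY : is_IntFrom 0 (fun y => IntFrom 0 (fun x => f x y))
               (IntFrom 0 (fun y => IntFrom 0 (fun x => f x y)))).
{ apply (is_IntFrom_dominated _ (K / l) m); auto.
  intros y Hy. replace (K / l * exp (- m * y)) with (K * exp (- m * y) / l) by (field; lra).
  apply (IntFrom_abs_le (fun x => f x y)); auto.
  - now apply (quadrant_section (fun y x => f x y)).
  - intros x Hx. eapply Rle_trans; [now apply Hb |]. right; ring. }
destruct HX as [HX HXb]. split; [exact HX |].
replace (IntFrom 0 (fun x => IntFrom 0 (f x)))
  with (IntFrom 0 (fun y => IntFrom 0 (fun x => f x y))); [exact HY |].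
apply Rminus_diag_uniq.
apply exp_decay_le_0 with (2 * (K / m / l)) l; [exact Hl |]. intros A HA.
pose proof (IntFrom_fubini_RInt f K m A Hf Hm HA Hby) as HF.
assert (HD : is_IntFrom 0 (fun y => IntFrom 0 (fun x => f x y) + -1 * RInt (fun x => f x y) 0 A)
  (IntFrom 0 (fun y => IntFrom 0 (fun x => f x y)) + -1 * RInt (fun x => IntFrom 0 (f x)) 0 A)).
{ apply is_IntFrom_plus; [exact HY |]. now apply is_IntFrom_scal. }
assert (HDb : Rabs (IntFrom 0 (fun y => IntFrom 0 (fun x => f x y))
                    + -1 * RInt (fun x => IntFrom 0 (f x)) 0 A) <= (K / l * exp (- l * A)) / m).
{ rewrite <- (IntFrom_unique _ _ _ HD). apply IntFrom_abs_le; [| exact Hm |].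
  - intros y. apply (continuous_plus (fun y => IntFrom 0 (fun x => f x (Rmax 0 y)))); [apply HYc |].
    apply (continuous_scal_r (-1) (fun y => RInt (fun x => f x (Rmax 0 y)) 0 A)).
    apply (quadrant_RInt (fun y x => f x y)); auto.
  - intros y Hy.
    replace (K / l * exp (- l * A) * exp (- m * y))
      with (K * exp (- m * y) / l * exp (- l * A)) by (field; lra).
    replace (IntFrom 0 (fun x => f x y) + -1 * RInt (fun x => f x y) 0 A)
      with (IntFrom 0 (fun x => f x y) - RInt (fun x => f x y) 0 A) by lra.
    apply (is_IntFrom_dominated (fun x => f x y)); auto.
    + now apply (quadrant_section (fun y x => f x y)).
    + intros x Hx. eapply Rle_trans; [now apply Hb |]. right; ring. }
specialize (HXb A HA).
replace (2 * (K / m / l) * exp (- l * A))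
  with (K / m / l * exp (- l * A) + K / l * exp (- l * A) / m) by (field; lra).
set (u := IntFrom 0 (fun y => IntFrom 0 (fun x => f x y))) in *.
set (v := IntFrom 0 (fun x => IntFrom 0 (f x))) in *.
set (w := RInt (fun x => IntFrom 0 (f x)) 0 A) in *.
set (p := K / m / l * exp (- l * A)) in *.
set (q := K / l * exp (- l * A) / m) in *. clearbody u v w p q.
unfold Rabs in *; repeat destruct Rcase_abs; lra.
Qed.

(** * The layer-cake identity *)

Lemma quadrant_mult (f g : R -> R -> R) :
  continuous_quadrant f -> continuous_quadrant g -> continuous_quadrant (fun x y => f x y * g x y).
Proof.
intros Hf Hg z.
apply (continuous_mult (fun z => f (Rmax 0 (fst z)) (Rmax 0 (snd z)))); [apply Hf | apply Hg].
Qed.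

Lemma quadrant_plus (f g : R -> R -> R) :
  continuous_quadrant f -> continuous_quadrant g -> continuous_quadrant (fun x y => f x y + g x y).
Proof.
intros Hf Hg z.
apply (continuous_plus (fun z => f (Rmax 0 (fst z)) (Rmax 0 (snd z)))); [apply Hf | apply Hg].
Qed.

Lemma quadrant_comp (g : R -> R) (f : R -> R -> R) :
  continuous_quadrant f -> (forall x y, 0 <= x -> 0 <= y -> continuous g (f x y)) ->
  continuous_quadrant (fun x y => g (f x y)).
Proof.
intros Hf Hg z.
apply (continuous_comp (fun z => f (Rmax 0 (fst z)) (Rmax 0 (snd z)))).
- apply Hf.
- apply Hg; apply Rmax_l.
Qed.

Lemma quadrant_fst (g : R -> R) :
  continuous_halfline g -> continuous_quadrant (fun x _ => g x).
Proof.
intros Hg [x y]. apply (continuous_comp fst (fun x => g (Rmax 0 x))).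
- apply continuous_fst.
- apply Hg.
Qed.

Lemma quadrant_snd (g : R -> R) :
  continuous_halfline g -> continuous_quadrant (fun _ y => g y).
Proof. intros Hg. apply (quadrant_swap (fun x _ => g x)). now apply quadrant_fst. Qed.

Lemma halfline_of_continuous (g : R -> R) :
  (forall x, continuous g x) -> continuous_halfline g.
Proof. intros Hg x. apply (continuous_comp (Rmax 0) g); [apply continuous_Rmax_0 | apply Hg]. Qed.

Lemma continuous_Rmin_l (u x : R) : continuous (Rmin u) x.
Proof.
apply continuous_ext with (fun x => u - Rmax 0 (u - x)).
- intros y. unfold Rmin, Rmax. destruct (Rle_dec u y), (Rle_dec 0 (u - y)); lra.
- apply (continuous_minus (fun _ => u) (fun x => Rmax 0 (u - x))); [apply continuous_const |].
  apply (continuous_comp (fun x => u - x) (Rmax 0)); [| apply continuous_Rmax_0].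
  apply (continuous_minus (fun _ => u) (fun x => x)); [apply continuous_const | apply continuous_id].
Qed.

(* [p] is a (not necessarily normalised) density on the half-line and [Q x] its mass
   beyond [x]. *)
Record tail_pair (p Q : R -> R) : Prop := {
  tail_cont : forall x, continuous p x;
  tail_derive : forall x, is_derive Q x (- p x);
  tail_bound : exists K l, 0 < l /\ forall x, 0 <= x ->
    Rabs (p x) <= K * exp (- l * x) /\ Rabs (Q x) <= K * exp (- l * x) }.

(* [phi x y] is a rate increasing in the gain [x], and [alpha r y] the gain at which it
   reaches the value [r]. *)
Record rate_pair (phi alpha : R -> R -> R) : Prop := {
  rate_cont : continuous_quadrant phi;
  inv_cont : continuous_quadrant alpha;
  inv_derive : forall r y, 0 <= y -> ex_derive (fun r => alpha r y) r;
  inv_0 : forall y, 0 <= y -> alpha 0 y = 0;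
  inv_ge0 : forall r y, 0 <= r -> 0 <= y -> 0 <= alpha r y;
  rate_inv : forall r y, 0 <= r -> 0 <= y -> phi (alpha r y) y = r;
  rate_mono : forall x x' y, 0 <= x <= x' -> 0 <= y -> phi x y <= phi x' y;
  rate_bound : exists k, 0 < k /\ forall x y, 0 <= x -> 0 <= y -> 0 <= phi x y <= k * x }.

Lemma tail_Q_cont (p Q : R -> R) : tail_pair p Q -> forall x, continuous Q x.
Proof.
intros H x. apply (ex_derive_continuous Q). exists (- p x). now apply tail_derive.
Qed.

Lemma exp_decay_mono (k x y : R) : 0 <= k -> x <= y -> exp (- k * y) <= exp (- k * x).
Proof.
intros Hk Hxy. destruct (Req_dec (k * x) (k * y)) as [h | h].
- right; f_equal; lra.
- apply Rlt_le, exp_increasing. nra.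
Qed.

Lemma exp_decay_rate_mono (k k' x : R) : k <= k' -> 0 <= x -> exp (- k' * x) <= exp (- k * x).
Proof.
intros Hk Hx. destruct (Req_dec (k * x) (k' * x)) as [h | h].
- right; f_equal; lra.
- apply Rlt_le, exp_increasing. nra.
Qed.

Lemma exp_decay_le_1 (k x : R) : 0 <= k -> 0 <= x -> exp (- k * x) <= 1.
Proof.
intros Hk Hx. pose proof (exp_decay_mono k 0 x Hk Hx). rewrite Rmult_0_r, exp_0 in H. exact H.
Qed.

(** Half of the exponent absorbs the factor [x], since k x / 2 <= exp(k x / 2). A linearly growing
    rate therefore costs half of the decay. *)
Lemma id_mult_exp_decay (k x : R) :
  0 < k -> 0 <= x -> x * exp (- k * x) <= 2 / k * exp (- (k / 2) * x).
Proof.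
intros Hk Hx.
replace (- k * x) with (- (k / 2) * x + - (k / 2) * x) by field. rewrite exp_plus.
rewrite <- Rmult_assoc. apply Rmult_le_compat_r; [apply Rlt_le, exp_pos |].
replace (- (k / 2) * x) with (- (k / 2 * x)) by ring. rewrite exp_Ropp.
pose proof (exp_ineq1_le (k / 2 * x)).
assert (0 < exp (k / 2 * x)) by apply exp_pos.
apply Rmult_le_reg_r with (exp (k / 2 * x)); [assumption |].
rewrite Rmult_assoc, Rinv_l, Rmult_1_r by lra.
apply Rmult_le_reg_l with (k / 2); [lra |].
replace (k / 2 * (2 / k * exp (k / 2 * x))) with (exp (k / 2 * x)) by (field; lra). lra.
Qed.

Lemma is_derive_RInt_upper (S : R -> R) (t : R) :
  (forall r, continuous S r) -> is_derive (RInt S 0) t (S t).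
Proof.
intros HS. apply (is_derive_RInt S _ 0 t); [| apply HS].
apply filter_forall. intros z. apply (RInt_correct S).
apply (ex_RInt_continuous (V := R_CompleteNormedModule)). intros; apply HS.
Qed.

(* Both sides vanish at [rho = 0] and have the same derivative [Q (alpha rho) * S rho]:
   since [phi (alpha rho) = rho], the two terms containing [alpha'] cancel. *)
Lemma layer_cake_RInt (p Q S phi alpha : R -> R) (rho : R) :
  (forall x, continuous p x) -> (forall x, is_derive Q x (- p x)) ->
  (forall r, continuous S r) -> continuous_halfline phi ->
  (forall r, ex_derive alpha r) -> alpha 0 = 0 ->
  (forall r, 0 <= r -> 0 <= alpha r /\ phi (alpha r) = r) -> 0 <= rho ->
  RInt (fun x => RInt S 0 (phi x) * p x) 0 (alpha rho) + Q (alpha rho) * RInt S 0 rho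
  = RInt (fun r => Q (alpha r) * S r) 0 rho.
Proof.
intros Hp HQ HS Hphi Hal Hal0 Hinv Hrho.
assert (HQc : forall x, continuous Q x).
{ intros x. apply (ex_derive_continuous Q). exists (- p x). apply HQ. }
(* Continuity of [phi] is assumed on the half-line only, while the derivative at [t = 0] may also
   see negative values of [alpha]. The clamp makes the integrand continuous everywhere and is
   removed at the end. *)
pose (g := fun x => RInt S 0 (phi (Rmax 0 x)) * p x).
assert (Hg : forall x, continuous g x).
{ intros x. apply (continuous_mult (fun x => RInt S 0 (phi (Rmax 0 x))) p); [| apply Hp].
  apply (continuous_comp (fun x => phi (Rmax 0 x)) (RInt S 0)); [apply Hphi |].
  apply (ex_derive_continuous (RInt S 0)). eexists. now apply is_derive_RInt_upper. }
assert (Hh : forall r, continuous (fun r => Q (alpha r) * S r) r).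
{ intros r. apply (continuous_mult (fun r => Q (alpha r)) S); [| apply HS].
  apply (continuous_comp alpha Q); [| apply HQc]. now apply (ex_derive_continuous alpha). }
pose (Phi := fun t => (RInt g 0 (alpha t) + Q (alpha t) * RInt S 0 t)
                      - RInt (fun r => Q (alpha r) * S r) 0 t).
assert (HPhi : forall t, 0 <= t -> is_derive Phi t 0).
{ intros t Ht. destruct (Hal t) as [d Hd]. destruct (Hinv t Ht) as [Hat Hpt].
  replace 0 with ((d * g (alpha t) + (d * (- p (alpha t)) * RInt S 0 t + Q (alpha t) * S t))
                  - Q (alpha t) * S t).
  2: { unfold g. rewrite Rmax_right, Hpt by exact Hat. ring. }
  apply (is_derive_minus (fun t => RInt g 0 (alpha t) + Q (alpha t) * RInt S 0 t)
           (RInt (fun r => Q (alpha r) * S r) 0)).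
  2: now apply (is_derive_RInt_upper (fun r => Q (alpha r) * S r)).
  apply (is_derive_plus (fun t => RInt g 0 (alpha t)) (fun t => Q (alpha t) * RInt S 0 t)).
  - apply (is_derive_comp (RInt g 0) alpha); [now apply is_derive_RInt_upper | exact Hd].
  - apply (is_derive_mult (fun t => Q (alpha t)) (RInt S 0)).
    + apply (is_derive_comp Q alpha); [apply HQ | exact Hd].
    + now apply is_derive_RInt_upper.
    + intros; apply Rmult_comm. }
assert (H0 : Phi 0 = 0).
{ unfold Phi. rewrite Hal0, !RInt_point. change zero with 0. ring. }
assert (HPr : Phi rho = 0).
{ destruct (Rle_lt_or_eq_dec 0 rho Hrho) as [h | h]; [| now rewrite <- h].
  rewrite <- H0. symmetry. apply eq_is_derive; [| exact h]. intros t Ht. apply HPhi; lra. }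
unfold Phi in HPr.
rewrite (RInt_ext (fun x => RInt S 0 (phi x) * p x) g); [lra |].
intros x Hx. destruct (Hinv rho Hrho) as [Hr _].
rewrite Rmin_left in Hx by exact Hr. unfold g. now rewrite Rmax_right by lra.
Qed.

(** Below the threshold [alpha u y] the minimum is [phi], and the layer-cake identity with weight 1
    applies. Above it the minimum is [u], and integrating [u * p] up to [b] yields u Q(alpha u y) -
    u Q(b). The first term cancels the boundary term of the identity and the second tends to 0. *)
Lemma layer_cake_min (p Q : R -> R) (phi alpha : R -> R -> R) (u y : R) :
  tail_pair p Q -> rate_pair phi alpha -> 0 <= u -> 0 <= y ->
  is_IntFrom 0 (fun x => Rmin u (phi x y) * p x) (RInt (fun r => Q (alpha r y)) 0 u).
Proof.
intros Ht Hr Hu Hy.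
assert (Hphi : continuous_halfline (fun x => phi x y)).
{ apply (quadrant_section (fun y x => phi x y)); auto. apply quadrant_swap, (rate_cont _ _ Hr). }
assert (Hex : forall a b, 0 <= a -> 0 <= b -> ex_RInt (fun x => Rmin u (phi x y) * p x) a b).
{ intros a b Ha Hb. apply halfline_ex_RInt; auto. intros x.
  apply (continuous_mult (fun x => Rmin u (phi (Rmax 0 x) y)) (fun x => p (Rmax 0 x))).
  - apply (continuous_comp (fun x => phi (Rmax 0 x) y) (Rmin u));
      [apply Hphi | apply continuous_Rmin_l].
  - apply halfline_of_continuous, (tail_cont _ _ Ht). }
pose proof (inv_ge0 _ _ Hr u y Hu Hy) as Ha.
apply is_IntFrom_lim; split; [intros b Hb; apply Hex; lra |].
apply is_lim_ext_loc with (fun b => RInt (fun r => Q (alpha r y)) 0 u + - u * Q b).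
- exists (alpha u y). intros b Hb.
  rewrite <- (RInt_Chasles_R _ 0 (alpha u y) b) by (apply Hex; lra).
  assert (E1 : RInt (fun x => Rmin u (phi x y) * p x) 0 (alpha u y) + Q (alpha u y) * u
               = RInt (fun r => Q (alpha r y)) 0 u).
  { pose proof (layer_cake_RInt p Q (fun _ => 1) (fun x => phi x y) (fun r => alpha r y) u
      (tail_cont _ _ Ht) (tail_derive _ _ Ht) (fun _ => continuous_const 1 _) Hphi
      (fun r => inv_derive _ _ Hr r y Hy) (inv_0 _ _ Hr y Hy)
      (fun r h => conj (inv_ge0 _ _ Hr r y h Hy) (rate_inv _ _ Hr r y h Hy)) Hu) as E.
    assert (E0 : forall v, RInt (fun _ => 1) 0 v = v).
    { intros v. rewrite RInt_const. unfold scal; simpl; unfold mult; simpl. ring. }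
    rewrite E0 in E.
    rewrite (RInt_ext (fun r => Q (alpha r y) * 1) (fun r => Q (alpha r y))) in E
      by (intros; apply Rmult_1_r).
    rewrite <- E. f_equal. apply RInt_ext. intros x Hx.
    rewrite Rmin_left, Rmax_right in Hx by exact Ha. rewrite E0. f_equal. apply Rmin_right.
    rewrite <- (rate_inv _ _ Hr u y Hu Hy). apply (rate_mono _ _ Hr); lra. }
  assert (E2 : RInt (fun x => Rmin u (phi x y) * p x) (alpha u y) b = - u * Q b - - u * Q (alpha u y)).
  { apply is_RInt_unique.
    apply (is_RInt_ext (fun x => u * p x)).
    - intros x Hx. rewrite Rmin_left in Hx by lra. f_equal. symmetry. apply Rmin_left.
      rewrite <- (rate_inv _ _ Hr u y Hu Hy) at 1. apply (rate_mono _ _ Hr); lra.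
    - apply (is_RInt_derive (fun x => - u * Q x)).
      + intros x _. replace (u * p x) with (- u * - p x) by ring.
        apply (is_derive_scal Q), (tail_derive _ _ Ht).
      + intros x _. apply (continuous_scal_r u p), (tail_cont _ _ Ht). }
  rewrite E2, <- E1. ring.
- destruct (tail_bound _ _ Ht) as [K [l [Hl HK]]].
  replace (RInt (fun r => Q (alpha r y)) 0 u) with (RInt (fun r => Q (alpha r y)) 0 u + - u * 0) at 1 by ring.
  apply (is_lim_plus' (fun _ => RInt (fun r => Q (alpha r y)) 0 u)); [apply is_lim_const |].
  apply (is_lim_scal_l Q (- u) p_infty 0).
  apply is_lim_exp_squeeze with K l; [exact Hl |]. intros x Hx. now apply HK.
Qed.

Lemma tail_bound_nonneg (K l x v : R) : Rabs v <= K * exp (- l * x) -> 0 <= K.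
Proof.
intros H. pose proof (Rabs_pos v). pose proof (exp_pos (- l * x)). nra.
Qed.

Lemma RInt_abs_le_linear (S : R -> R) (M u : R) :
  (forall r, continuous S r) -> (forall r, 0 <= r -> Rabs (S r) <= M) -> 0 <= u ->
  Rabs (RInt S 0 u) <= M * u.
Proof.
intros HS HM Hu. replace (M * u) with ((u - 0) * M) by ring.
apply (abs_RInt_le_const S); [exact Hu | |].
- apply (ex_RInt_continuous (V := R_CompleteNormedModule)). intros; apply HS.
- intros t Ht. apply HM; lra.
Qed.

(** The integral of a bounded weight up to [phi x y] is at most M k x, a growth absorbed by half of
    the decay of [p]; the constants do not involve [y]. *)
Lemma rate_weight_dominated (p Q S : R -> R) (phi alpha : R -> R -> R) (M : R) :
  tail_pair p Q -> rate_pair phi alpha ->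
  (forall r, continuous S r) -> (forall r, 0 <= r -> Rabs (S r) <= M) ->
  exists K l, 0 < l /\ forall x y, 0 <= x -> 0 <= y ->
    Rabs (RInt S 0 (phi x y) * p x) <= K * exp (- l * x).
Proof.
intros Ht Hr HS HM.
destruct (tail_bound _ _ Ht) as [K [l [Hl HK]]].
destruct (rate_bound _ _ Hr) as [k [Hk Hphi]].
exists (M * k * K * (2 / l)), (l / 2). split; [lra |]. intros x y Hx Hy.
destruct (HK x Hx) as [Hp _]. destruct (Hphi x y Hx Hy) as [H0 H1].
pose proof (tail_bound_nonneg _ _ _ _ Hp) as HK0.
assert (HM0 : 0 <= M) by (specialize (HM 0 (Rle_refl 0)); pose proof (Rabs_pos (S 0)); lra).
pose proof (RInt_abs_le_linear S M _ HS HM H0) as HG.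
rewrite Rabs_mult.
apply Rle_trans with (M * (k * x) * (K * exp (- l * x))).
- apply Rmult_le_compat; try apply Rabs_pos; [| exact Hp].
  eapply Rle_trans; [exact HG |]. now apply Rmult_le_compat_l.
- replace (M * (k * x) * (K * exp (- l * x))) with (M * k * K * (x * exp (- l * x))) by ring.
  rewrite (Rmult_assoc (M * k * K)). apply Rmult_le_compat_l.
  + apply Rmult_le_pos; [apply Rmult_le_pos |]; lra.
  + now apply id_mult_exp_decay.
Qed.

(** Evaluating the linear bound on [phi] at the threshold gives alpha r y >= r / k. Decay in the
    gain thus becomes decay in the rate, uniformly in [y]. *)
Lemma inv_tail_dominated (p Q : R -> R) (phi alpha : R -> R -> R) :
  tail_pair p Q -> rate_pair phi alpha ->
  exists K l, 0 < l /\ forall r y, 0 <= r -> 0 <= y ->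
    Rabs (Q (alpha r y)) <= K * exp (- l * r).
Proof.
intros Ht Hr.
destruct (tail_bound _ _ Ht) as [K [l [Hl HK]]].
destruct (rate_bound _ _ Hr) as [k [Hk Hphi]].
exists K, (l / k). split; [now apply Rdiv_lt_0_compat |]. intros r y Hrr Hy.
pose proof (inv_ge0 _ _ Hr r y Hrr Hy) as Ha.
destruct (HK _ Ha) as [_ HQ]. pose proof (tail_bound_nonneg _ _ _ _ HQ) as HK0.
eapply Rle_trans; [exact HQ |]. apply Rmult_le_compat_l; [exact HK0 |].
destruct (Hphi _ _ Ha Hy) as [_ H1]. rewrite (rate_inv _ _ Hr r y Hrr Hy) in H1.
replace (- (l / k) * r) with (- l * (r / k)) by (field; lra).
apply exp_decay_mono; [lra |].
apply Rmult_le_reg_l with k; [exact Hk |]. replace (k * (r / k)) with r by (field; lra). exact H1.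
Qed.

Lemma quadrant_RInt_rate (S : R -> R) (phi alpha : R -> R -> R) :
  rate_pair phi alpha -> (forall r, continuous S r) ->
  continuous_quadrant (fun x y => RInt S 0 (phi x y)).
Proof.
intros Hr HS. apply (quadrant_comp (RInt S 0)); [apply (rate_cont _ _ Hr) |].
intros x y _ _. apply (ex_derive_continuous (RInt S 0)). eexists. now apply is_derive_RInt_upper.
Qed.

(** This is [layer_cake_RInt] as rho tends to infinity: for bounded [S] the boundary term is of
    order rho exp(-l2 rho), and both truncated integrals converge exponentially fast. *)
Lemma layer_cake (p Q S : R -> R) (phi alpha : R -> R -> R) (M y : R) :
  tail_pair p Q -> rate_pair phi alpha ->
  (forall r, continuous S r) -> (forall r, 0 <= r -> Rabs (S r) <= M) -> 0 <= y ->
  exists v, is_IntFrom 0 (fun x => RInt S 0 (phi x y) * p x) v /\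
            is_IntFrom 0 (fun r => Q (alpha r y) * S r) v.
Proof.
intros Ht Hr HS HM Hy.
destruct (rate_weight_dominated p Q S phi alpha M Ht Hr HS HM) as [K1 [l1 [Hl1 HK1]]].
destruct (inv_tail_dominated p Q phi alpha Ht Hr) as [K2 [l2 [Hl2 HK2]]].
destruct (rate_bound _ _ Hr) as [k [Hk Hphi]].
assert (HM0 : 0 <= M) by (specialize (HM 0 (Rle_refl 0)); pose proof (Rabs_pos (S 0)); lra).
assert (HP : continuous_halfline (fun x => phi x y)).
{ apply (quadrant_section (fun y x => phi x y)); auto. apply quadrant_swap, (rate_cont _ _ Hr). }
destruct (is_IntFrom_dominated (fun x => RInt S 0 (phi x y) * p x) K1 l1) as [H1 T1]; auto.
{ apply (quadrant_section (fun y x => RInt S 0 (phi x y) * p x)); [| exact Hy].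
  apply (quadrant_swap (fun x y => RInt S 0 (phi x y) * p x)).
  apply (quadrant_mult (fun x y => RInt S 0 (phi x y)) (fun x _ => p x)).
  - now apply quadrant_RInt_rate with alpha.
  - apply quadrant_fst, halfline_of_continuous, (tail_cont _ _ Ht). }
destruct (is_IntFrom_dominated (fun r => Q (alpha r y) * S r) (K2 * M) l2) as [H2 T2]; auto.
{ apply halfline_of_continuous. intros r.
  apply (continuous_mult (fun r => Q (alpha r y)) S); [| apply HS].
  apply (continuous_comp (fun r => alpha r y) Q); [| apply (tail_Q_cont _ _ Ht)].
  apply (ex_derive_continuous (fun r => alpha r y)), (inv_derive _ _ Hr); exact Hy. }
{ intros r Hr0. rewrite Rabs_mult.
  replace (K2 * M * exp (- l2 * r)) with (K2 * exp (- l2 * r) * M) by ring.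
  apply Rmult_le_compat; auto using Rabs_pos. }
set (v1 := IntFrom 0 (fun x => RInt S 0 (phi x y) * p x)) in *.
set (v2 := IntFrom 0 (fun r => Q (alpha r y) * S r)) in *.
exists v1. split; [exact H1 |]. replace v1 with v2; [exact H2 |].
symmetry. apply Rminus_diag_uniq.
assert (HK1' : 0 <= K1) by (apply (tail_bound_nonneg K1 l1 0 _ (HK1 0 y (Rle_refl 0) Hy))).
assert (HK2' : 0 <= K2) by (apply (tail_bound_nonneg K2 l2 0 _ (HK2 0 y (Rle_refl 0) Hy))).
(* A common rate for three errors: the tail in the gain starts at alpha rho >= rho / k, hence l1 /
   k; the boundary term spends half of its decay on the factor rho, hence l2 / 2; the tail in [r]
   decays faster still. The constant used below adds their coefficients in this order. *)
pose (l := Rmin (l1 / k) (l2 / 2)).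
assert (Hl : 0 < l).
{ unfold l. apply Rmin_glb_lt; [now apply Rdiv_lt_0_compat | lra]. }
apply exp_decay_le_0 with (K1 / l1 + K2 * M * (2 / l2) + K2 * M / l2) l; [exact Hl |].
intros rho Hrho.
pose proof (inv_ge0 _ _ Hr rho y Hrho Hy) as Ha.
specialize (T1 _ Ha). specialize (T2 _ Hrho).
pose proof (layer_cake_RInt p Q S (fun x => phi x y) (fun r => alpha r y) rho
      (tail_cont _ _ Ht) (tail_derive _ _ Ht) HS HP
      (fun r => inv_derive _ _ Hr r y Hy) (inv_0 _ _ Hr y Hy)
      (fun r h => conj (inv_ge0 _ _ Hr r y h Hy) (rate_inv _ _ Hr r y h Hy)) Hrho) as E.
assert (B1 : K1 / l1 * exp (- l1 * alpha rho y) <= K1 / l1 * exp (- l * rho)).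
{ apply Rmult_le_compat_l; [now apply Rdiv_le_0_compat |].
  apply Rle_trans with (exp (- (l1 / k) * rho)).
  - replace (- (l1 / k) * rho) with (- l1 * (rho / k)) by (field; lra).
    apply exp_decay_mono; [lra |].
    destruct (Hphi _ _ Ha Hy) as [_ Hk1]. rewrite (rate_inv _ _ Hr rho y Hrho Hy) in Hk1.
    apply Rmult_le_reg_l with k; [exact Hk |].
    replace (k * (rho / k)) with rho by (field; lra). exact Hk1.
  - apply exp_decay_rate_mono; [apply Rmin_l | exact Hrho]. }
assert (D2 : exp (- (l2 / 2) * rho) <= exp (- l * rho)).
{ apply exp_decay_rate_mono; [apply Rmin_r | exact Hrho]. }
assert (B2 : Rabs (Q (alpha rho y) * RInt S 0 rho) <= K2 * M * (2 / l2) * exp (- l * rho)).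
{ rewrite Rabs_mult.
  apply Rle_trans with (K2 * exp (- l2 * rho) * (M * rho)).
  - apply Rmult_le_compat; auto using Rabs_pos. now apply RInt_abs_le_linear.
  - replace (K2 * exp (- l2 * rho) * (M * rho)) with (K2 * M * (rho * exp (- l2 * rho))) by ring.
    rewrite (Rmult_assoc (K2 * M)). apply Rmult_le_compat_l; [now apply Rmult_le_pos |].
    eapply Rle_trans; [now apply id_mult_exp_decay |].
    apply Rmult_le_compat_l; [| exact D2]. apply Rdiv_le_0_compat; lra. }
assert (B3 : K2 * M / l2 * exp (- l2 * rho) <= K2 * M / l2 * exp (- l * rho)).
{ apply Rmult_le_compat_l; [apply Rdiv_le_0_compat; [now apply Rmult_le_pos | exact Hl2] |].
  eapply Rle_trans; [| exact D2]. apply exp_decay_rate_mono; lra. }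
rewrite !Rmult_plus_distr_r.
set (I1 := RInt (fun x => RInt S 0 (phi x y) * p x) 0 (alpha rho y)) in *.
set (I2 := RInt (fun r => Q (alpha r y) * S r) 0 rho) in *.
set (q := Q (alpha rho y) * RInt S 0 rho) in *.
assert (E' : v1 - v2 = (v1 - I1) - q - (v2 - I2)) by lra.
rewrite E'.
pose proof (Rle_trans _ _ _ T1 B1) as C1. pose proof (Rle_trans _ _ _ T2 B3) as C3.
apply Rle_trans with (Rabs (v1 - I1) + Rabs q + Rabs (v2 - I2)); [| lra].
unfold Rabs; repeat destruct Rcase_abs; lra.
Qed.

Lemma IntFrom_scal (a k : R) (f : R -> R) (v : R) :
  is_IntFrom a f v -> IntFrom a (fun x => k * f x) = k * IntFrom a f.
Proof.
intros H. rewrite (IntFrom_unique a f v H).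
now apply IntFrom_unique, is_IntFrom_scal.
Qed.

(** [Rmin u] bounds the integrand, so the gains can be exchanged, [layer_cake_min] applied for fixed
    [y], and the finite range [0, u] of [r] moved outside. The first conclusion records convergence
    of the inner integrals, which is what allows constant factors to be pulled out of [IntFrom]
    later. *)
Lemma expectation_Rmin_const (p Q p' Q' : R -> R) (phi alpha : R -> R -> R) (u : R) :
  tail_pair p Q -> tail_pair p' Q' -> rate_pair phi alpha -> 0 <= u ->
  (forall x, 0 <= x -> exists v, is_IntFrom 0 (fun y => Rmin u (phi x y) * p x * p' y) v) /\
  is_IntFrom 0 (fun x => IntFrom 0 (fun y => Rmin u (phi x y) * p x * p' y))
    (RInt (fun r => IntFrom 0 (fun y => Q (alpha r y) * p' y)) 0 u).
Proof.
intros Ht Ht' Hr Hu.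
destruct (tail_bound _ _ Ht) as [K [l [Hl HK]]].
destruct (tail_bound _ _ Ht') as [K' [l' [Hl' HK']]].
destruct (rate_bound _ _ Hr) as [k [Hk Hphi]].
assert (HK0 : 0 <= K) by (apply (tail_bound_nonneg K l 0 (p 0)), HK, Rle_refl).
assert (HK0' : 0 <= K') by (apply (tail_bound_nonneg K' l' 0 (p' 0)), HK', Rle_refl).
assert (Hp' : continuous_quadrant (fun _ y => p' y)).
{ apply quadrant_snd, halfline_of_continuous, (tail_cont _ _ Ht'). }
assert (Hc : continuous_quadrant (fun x y => Rmin u (phi x y) * p x * p' y)).
{ apply (quadrant_mult (fun x y => Rmin u (phi x y) * p x) (fun _ y => p' y)); [| exact Hp'].
  apply (quadrant_mult (fun x y => Rmin u (phi x y)) (fun x _ => p x)).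
  - apply (quadrant_comp (Rmin u)); [apply (rate_cont _ _ Hr) |].
    intros; apply continuous_Rmin_l.
  - apply quadrant_fst, halfline_of_continuous, (tail_cont _ _ Ht). }
assert (Hdom : forall x y, 0 <= x -> 0 <= y ->
  Rabs (Rmin u (phi x y) * p x * p' y) <= u * K * K' * exp (- l * x) * exp (- l' * y)).
{ intros x y Hx Hy. rewrite !Rabs_mult.
  replace (u * K * K' * exp (- l * x) * exp (- l' * y))
    with (u * (K * exp (- l * x)) * (K' * exp (- l' * y))) by ring.
  destruct (HK x Hx) as [h _]. destruct (HK' y Hy) as [h' _].
  destruct (Hphi x y Hx Hy) as [h0 _].
  apply Rmult_le_compat; [apply Rmult_le_pos; apply Rabs_pos | apply Rabs_pos | | exact h'].
  apply Rmult_le_compat; auto using Rabs_pos.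
  rewrite Rabs_right; [apply Rmin_l | apply Rle_ge, Rmin_glb; lra]. }
split.
- intros x Hx. eexists.
  apply (is_IntFrom_dominated (fun y => Rmin u (phi x y) * p x * p' y)
           (u * K * K' * exp (- l * x)) l'); auto.
  now apply (quadrant_section (fun x y => Rmin u (phi x y) * p x * p' y)).
- destruct (IntFrom_fubini (fun x y => Rmin u (phi x y) * p x * p' y)) as [F1 F2]; auto.
  { exists (u * K * K'), l, l'. auto. }
  match type of F1 with is_IntFrom _ _ ?v => set (w := v) in * end.
  match goal with |- is_IntFrom _ _ ?v => replace v with w; [exact F1 |] end.
  rewrite <- (IntFrom_unique _ _ _ F2).
  apply IntFrom_unique.
  apply is_IntFrom_ext with (fun y => RInt (fun r => Q (alpha r y) * p' y) 0 u).
  + intros y Hy. symmetry. apply IntFrom_unique.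
    pose proof (layer_cake_min p Q phi alpha u y Ht Hr Hu Hy) as L.
    apply (is_IntFrom_scal 0 (p' y)) in L.
    replace (RInt (fun r => Q (alpha r y) * p' y) 0 u)
      with (p' y * RInt (fun r => Q (alpha r y)) 0 u).
    * apply is_IntFrom_ext with (2 := L). intros; ring.
    * change (p' y * RInt (fun r => Q (alpha r y)) 0 u)
        with (scal (p' y) (RInt (fun r => Q (alpha r y)) 0 u)).
      rewrite <- (RInt_scal (fun r => Q (alpha r y)) 0 u (p' y)).
      -- apply RInt_ext. intros; apply Rmult_comm.
      -- apply halfline_ex_RInt; try lra.
         apply (quadrant_section (fun y r => Q (alpha r y))); [| exact Hy].
         apply (quadrant_swap (fun r y => Q (alpha r y))).
         apply (quadrant_comp Q); [apply (inv_cont _ _ Hr) |].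
         intros; apply (tail_Q_cont _ _ Ht).
  + apply (IntFrom_fubini_RInt (fun r y => Q (alpha r y) * p' y) (K * K') l'); auto.
    * apply (quadrant_mult (fun r y => Q (alpha r y)) (fun _ y => p' y)); [| exact Hp'].
      apply (quadrant_comp Q); [apply (inv_cont _ _ Hr) |].
      intros; apply (tail_Q_cont _ _ Ht).
    * intros r y Hr0 Hy. rewrite Rabs_mult.
      pose proof (inv_ge0 _ _ Hr r y Hr0 Hy) as Ha.
      destruct (HK _ Ha) as [_ h]. destruct (HK' y Hy) as [h' _].
      rewrite Rmult_assoc.
      apply Rmult_le_compat; auto using Rabs_pos.
      eapply Rle_trans; [exact h |]. pose proof (exp_decay_le_1 l (alpha r y) (Rlt_le _ _ Hl) Ha).
      rewrite <- (Rmult_1_r K) at 2. now apply Rmult_le_compat_l.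
Qed.

Lemma expectation_Rmin_tails (p1 Q1 p2 Q2 p3 Q3 p4 Q4 : R -> R)
  (phi1 alpha1 phi2 alpha2 : R -> R -> R) :
  tail_pair p1 Q1 -> tail_pair p2 Q2 -> tail_pair p3 Q3 -> tail_pair p4 Q4 ->
  rate_pair phi1 alpha1 -> rate_pair phi2 alpha2 ->
  exists v,
    is_IntFrom 0 (fun a => IntFrom 0 (fun b => IntFrom 0 (fun c => IntFrom 0 (fun d =>
      Rmin (phi1 a b) (phi2 c d) * p1 a * p2 b * p3 c * p4 d)))) v /\
    is_IntFrom 0 (fun r => IntFrom 0 (fun b =>
      Q1 (alpha1 r b) * IntFrom 0 (fun d => Q3 (alpha2 r d) * p4 d) * p2 b)) v.
Proof.
intros H1 H2 H3 H4 Hr1 Hr2.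
pose (S := fun r => IntFrom 0 (fun d => Q3 (alpha2 r d) * p4 d)).
destruct (tail_bound _ _ H3) as [K3 [l3 [Hl3 HK3]]].
destruct (tail_bound _ _ H4) as [K4 [l4 [Hl4 HK4]]].
destruct (tail_bound _ _ H2) as [K2 [l2 [Hl2 HK2]]].
destruct (rate_bound _ _ Hr1) as [k1 [Hk1 Hphi1]].
assert (HK30 : 0 <= K3) by (apply (tail_bound_nonneg K3 l3 0 (p3 0)), HK3, Rle_refl).
assert (HK40 : 0 <= K4) by (apply (tail_bound_nonneg K4 l4 0 (p4 0)), HK4, Rle_refl).
assert (HK20 : 0 <= K2) by (apply (tail_bound_nonneg K2 l2 0 (p2 0)), HK2, Rle_refl).
assert (HSq : continuous_quadrant (fun r d => Q3 (alpha2 r d) * p4 d)).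
{ apply (quadrant_mult (fun r y => Q3 (alpha2 r y)) (fun _ y => p4 y)).
  - apply (quadrant_comp Q3); [apply (inv_cont _ _ Hr2) |]. intros; apply (tail_Q_cont _ _ H3).
  - apply quadrant_snd, halfline_of_continuous, (tail_cont _ _ H4). }
assert (HSb : forall r d, 0 <= r -> 0 <= d ->
  Rabs (Q3 (alpha2 r d) * p4 d) <= K3 * K4 * exp (- l4 * d)).
{ intros r d Hr Hd. rewrite Rabs_mult.
  pose proof (inv_ge0 _ _ Hr2 r d Hr Hd) as Ha.
  destruct (HK3 _ Ha) as [_ h]. destruct (HK4 d Hd) as [h' _].
  rewrite Rmult_assoc. apply Rmult_le_compat; auto using Rabs_pos.
  eapply Rle_trans; [exact h |].
  pose proof (exp_decay_le_1 l3 (alpha2 r d) (Rlt_le _ _ Hl3) Ha).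
  rewrite <- (Rmult_1_r K3) at 2. now apply Rmult_le_compat_l. }
assert (HSc : continuous_halfline S).
{ now apply (quadrant_IntFrom (fun r d => Q3 (alpha2 r d) * p4 d) (K3 * K4) l4). }
pose (M := K3 * K4 / l4).
assert (HSM : forall r, 0 <= r -> Rabs (S r) <= M).
{ intros r Hr. unfold S, M. apply IntFrom_abs_le; auto.
  now apply (quadrant_section (fun r d => Q3 (alpha2 r d) * p4 d)). }
(* The weight in [layer_cake] must be continuous on the whole line, so [S] is extended by its value
   at 0. *)
pose (S' := fun r => S (Rmax 0 r)).
assert (HS'c : forall r, continuous S' r) by exact HSc.
assert (HS'M : forall r, 0 <= r -> Rabs (S' r) <= M).
{ intros r Hr. apply HSM, Rmax_l. }
(* [F] is what the expectation leaves after integration over [c] and [d]. Exchanging [a] and [b]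
   makes [a] innermost, the layer-cake identity at fixed [b] replaces it by [r] and turns [F] into
   the [G] below, and a second exchange brings [r] outside. *)
pose (F := fun a b => RInt S' 0 (phi1 a b) * p1 a * p2 b).
assert (Hp2 : continuous_quadrant (fun _ y => p2 y)).
{ apply quadrant_snd, halfline_of_continuous, (tail_cont _ _ H2). }
destruct (IntFrom_fubini F) as [F1 F2].
{ apply (quadrant_mult (fun a b => RInt S' 0 (phi1 a b) * p1 a) (fun _ y => p2 y)); [| exact Hp2].
  apply (quadrant_mult (fun a b => RInt S' 0 (phi1 a b)) (fun a _ => p1 a)).
  - now apply quadrant_RInt_rate with alpha1.
  - apply quadrant_fst, halfline_of_continuous, (tail_cont _ _ H1). }
{ destruct (rate_weight_dominated p1 Q1 S' phi1 alpha1 M H1 Hr1 HS'c HS'M) as [K [l [Hl HK]]].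
  exists (K * K2), l, l2. repeat split; auto. intros a b Ha Hb. unfold F. rewrite Rabs_mult.
  destruct (HK2 b Hb) as [h _].
  replace (K * K2 * exp (- l * a) * exp (- l2 * b))
    with ((K * exp (- l * a)) * (K2 * exp (- l2 * b))) by ring.
  apply Rmult_le_compat; auto using Rabs_pos. }
pose (G := fun r b => Q1 (alpha1 r b) * S' r * p2 b).
destruct (IntFrom_fubini G) as [G1 G2].
{ apply (quadrant_mult (fun r b => Q1 (alpha1 r b) * S' r) (fun _ y => p2 y)); [| exact Hp2].
  apply (quadrant_mult (fun r b => Q1 (alpha1 r b)) (fun r _ => S' r)).
  - apply (quadrant_comp Q1); [apply (inv_cont _ _ Hr1) |]. intros; apply (tail_Q_cont _ _ H1).
  - apply quadrant_fst, halfline_of_continuous, HS'c. }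
{ destruct (inv_tail_dominated p1 Q1 phi1 alpha1 H1 Hr1) as [K [l [Hl HK]]].
  exists (K * M * K2), l, l2. repeat split; auto. intros r b Hr Hb. unfold G. rewrite !Rabs_mult.
  destruct (HK2 b Hb) as [h _].
  replace (K * M * K2 * exp (- l * r) * exp (- l2 * b))
    with ((K * exp (- l * r)) * M * (K2 * exp (- l2 * b))) by ring.
  apply Rmult_le_compat; auto using Rabs_pos, Rmult_le_pos.
  apply Rmult_le_compat; auto using Rabs_pos. }
set (v := IntFrom 0 (fun x => IntFrom 0 (F x))) in *.
set (w := IntFrom 0 (fun x => IntFrom 0 (G x))) in *.
exists v. split.
- apply is_IntFrom_ext with (2 := F1). intros a Ha. apply IntFrom_ext. intros b Hb.
  destruct (Hphi1 a b Ha Hb) as [Hu _].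
  destruct (expectation_Rmin_const p3 Q3 p4 Q4 phi2 alpha2 (phi1 a b) H3 H4 Hr2 Hu) as [E1 E2].
  symmetry. apply IntFrom_unique.
  change (RInt (fun r => IntFrom 0 (fun y => Q3 (alpha2 r y) * p4 y)) 0 (phi1 a b))
    with (RInt S 0 (phi1 a b)) in E2.
  rewrite <- (RInt_clamp S) in E2 by lra.
  apply (is_IntFrom_scal 0 (p1 a * p2 b)) in E2.
  replace (F a b) with (p1 a * p2 b * RInt S' 0 (phi1 a b)) by (unfold F; ring).
  apply is_IntFrom_ext with (2 := E2). intros c Hc. destruct (E1 c Hc) as [z Hz].
  rewrite <- (IntFrom_scal _ _ _ _ Hz). apply IntFrom_ext. intros; ring.
- assert (Hvw : v = w).
  { rewrite <- (IntFrom_unique _ _ _ F2), <- (IntFrom_unique _ _ _ G2).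
    apply IntFrom_ext. intros b Hb.
    destruct (layer_cake p1 Q1 S' phi1 alpha1 M b H1 Hr1 HS'c HS'M Hb) as [z [Z1 Z2]].
    apply (is_IntFrom_scal 0 (p2 b)) in Z1. apply (is_IntFrom_scal 0 (p2 b)) in Z2.
    transitivity (p2 b * z); [| symmetry]; apply IntFrom_unique.
    - apply is_IntFrom_ext with (2 := Z1). intros; unfold F; ring.
    - apply is_IntFrom_ext with (2 := Z2). intros; unfold G; ring. }
  rewrite Hvw. apply is_IntFrom_ext with (2 := G1). intros r Hr. apply IntFrom_ext.
  intros b Hb. unfold G, S'. now rewrite Rmax_right.
Qed.

(** * Gamma tails *)

(** The rate is halved at each step of the induction: one half absorbs a factor [x], the other the
    remaining power. *)
Lemma pow_le_exp (n : nat) : forall l, 0 < l ->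
  exists K, 0 <= K /\ forall x, 0 <= x -> x ^ n <= K * exp (l * x).
Proof.
induction n as [| n IH]; intros l Hl.
- exists 1. split; [lra |]. intros x Hx. simpl. pose proof (exp_ineq1_le (l * x)). nra.
- destruct (IH (l / 2)) as [K [HK0 HK]]; [lra |].
  exists (2 / l * K). split; [apply Rmult_le_pos; [apply Rdiv_le_0_compat |]; lra |].
  intros x Hx. simpl.
  replace (2 / l * K * exp (l * x)) with ((2 / l * exp (l / 2 * x)) * (K * exp (l / 2 * x))).
  2: { replace (l * x) with (l / 2 * x + l / 2 * x) by field. rewrite exp_plus. ring. }
  apply Rmult_le_compat; [exact Hx | now apply pow_le | | now apply HK].
  pose proof (exp_ineq1_le (l / 2 * x)).
  apply Rmult_le_reg_l with (l / 2); [lra |].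
  replace (l / 2 * (2 / l * exp (l / 2 * x))) with (exp (l / 2 * x)) by (field; lra). lra.
Qed.

(* The regularised incomplete gamma function Gamma(n+1, x) / n!. *)
Definition gamma_tail (n : nat) (x : R) : R :=
  exp (- x) * sum_f_R0 (fun j => x ^ j / INR (fact j)) n.

(** The derivative telescopes: the summand of degree n + 1 contributes exp(-x) (x^n / n! - x^(n+1) /
    (n+1)!), whose first part cancels the derivative obtained so far. *)
Lemma is_derive_gamma_tail (n : nat) (x : R) :
  is_derive (gamma_tail n) x (- (x ^ n * exp (- x) / INR (fact n))).
Proof.
induction n as [| n IH].
- unfold gamma_tail; simpl. auto_derive; [exact I |]. simpl. field.
- apply is_derive_ext with
    (fun x => gamma_tail n x + exp (- x) * (x ^ (S n) / INR (fact (S n)))).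
  { intros t. unfold gamma_tail. rewrite tech5. symmetry. apply Rmult_plus_distr_l. }
  replace (- (x ^ S n * exp (- x) / INR (fact (S n)))) with
    (- (x ^ n * exp (- x) / INR (fact n))
     + (exp (- x) * (x ^ n / INR (fact n)) - exp (- x) * (x ^ S n / INR (fact (S n))))) by
    (field; split; apply INR_fact_neq_0).
  apply (is_derive_plus (gamma_tail n)); [exact IH |].
  assert (Hf : INR (S n) / INR (fact (S n)) = / INR (fact n)).
  { change (fact (S n)) with (S n * fact n)%nat. rewrite mult_INR.
    field. split; [apply INR_fact_neq_0 | apply not_0_INR; lia]. }
  replace (x ^ n / INR (fact n)) with (x ^ n * (INR (S n) / INR (fact (S n))))
    by (rewrite Hf; reflexivity).
  generalize (INR (fact (S n))). intros c.
  auto_derive; [exact I |].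
  change (Nat.pred (S n)) with n. change (match n with 0%nat => 1 | S _ => INR n + 1 end) with (INR (S n)).
  unfold Rdiv. change (x ^ S n) with (x * x ^ n). ring.
Qed.

(** The rate 1/2 is what remains of exp(-x) after exp(x/2) has absorbed the polynomial factor. *)
Lemma gamma_tail_bound (n : nat) :
  exists K, forall x, 0 <= x -> Rabs (gamma_tail n x) <= K * exp (- / 2 * x).
Proof.
assert (H : exists K, 0 <= K /\ forall x, 0 <= x ->
  Rabs (sum_f_R0 (fun j => x ^ j / INR (fact j)) n) <= K * exp (/ 2 * x)).
{ induction n as [| n [K [HK0 HK]]].
  - destruct (pow_le_exp 0 (/ 2)) as [K [HK0 HK]]; [lra |]. exists K. split; [exact HK0 |].
    intros x Hx. specialize (HK x Hx). simpl in *. unfold Rdiv. rewrite Rinv_1, Rmult_1_l, Rabs_R1.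
    exact HK.
  - destruct (pow_le_exp (S n) (/ 2)) as [K' [HK0' HK']]; [lra |].
    exists (K + K' / INR (fact (S n))). pose proof (INR_fact_lt_0 (S n)) as Hf. split.
    { apply Rplus_le_le_0_compat; [exact HK0 |]. now apply Rdiv_le_0_compat. }
    intros x Hx. rewrite tech5. eapply Rle_trans; [apply Rabs_triang |].
    rewrite Rmult_plus_distr_r. apply Rplus_le_compat; [now apply HK |].
    unfold Rdiv. rewrite Rabs_right.
    + rewrite Rmult_assoc, (Rmult_comm (/ _)), <- Rmult_assoc.
      apply Rmult_le_compat_r; [now apply Rlt_le, Rinv_0_lt_compat | now apply HK'].
    + apply Rle_ge, Rmult_le_pos; [now apply pow_le | now apply Rlt_le, Rinv_0_lt_compat]. }
destruct H as [K [_ HK]]. exists K. intros x Hx. unfold gamma_tail.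
rewrite Rabs_mult, (Rabs_right (exp (- x))) by (apply Rle_ge, Rlt_le, exp_pos).
replace (- / 2 * x) with (- x + / 2 * x) by field. rewrite exp_plus.
rewrite <- Rmult_assoc, (Rmult_comm K), Rmult_assoc.
apply Rmult_le_compat_l; [apply Rlt_le, exp_pos | now apply HK].
Qed.

Lemma is_lim_gamma_tail_scal (n : nat) (l : R) :
  0 < l -> is_lim (fun x => gamma_tail n (l * x)) p_infty 0.
Proof.
intros Hl. destruct (gamma_tail_bound n) as [K HK].
apply is_lim_exp_squeeze with K (/ 2 * l); [apply Rmult_lt_0_compat; lra |].
intros x Hx. replace (- (/ 2 * l) * x) with (- / 2 * (l * x)) by ring.
apply HK, Rmult_le_pos; lra.
Qed.

Lemma is_IntFrom_pow_exp (n : nat) (l a : R) :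
  0 < l -> is_IntFrom a (fun t => t ^ n * exp (- (l * t)))
             (INR (fact n) / l ^ (n + 1) * gamma_tail n (l * a)).
Proof.
intros Hl.
replace (INR (fact n) / l ^ (n + 1) * gamma_tail n (l * a))
  with (0 - - (INR (fact n) / l ^ (n + 1)) * gamma_tail n (l * a)) by ring.
apply (is_IntFrom_antiderivative a _
         (fun t => - (INR (fact n) / l ^ (n + 1)) * gamma_tail n (l * t))).
- intros x _.
  replace (x ^ n * exp (- (l * x)))
    with (- (INR (fact n) / l ^ (n + 1)) * (l * - ((l * x) ^ n * exp (- (l * x)) / INR (fact n)))).
  + apply (is_derive_scal (fun t => gamma_tail n (l * t))).
    apply (is_derive_comp (gamma_tail n) (fun t => l * t)); [apply is_derive_gamma_tail |].
    auto_derive; [exact I | ring].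
  + rewrite Rpow_mult_distr, pow_add. field.
    repeat split; try apply INR_fact_neq_0; try apply pow_nonzero; lra.
- intros x _. apply (ex_derive_continuous (fun t => t ^ n * exp (- (l * t)))). auto_derive. exact I.
- replace (Finite 0) with (Rbar_mult (- (INR (fact n) / l ^ (n + 1))) (Finite 0))
    by (simpl; f_equal; ring).
  apply (is_lim_scal_l (fun t => gamma_tail n (l * t)) _ p_infty 0).
  now apply is_lim_gamma_tail_scal.
Qed.

Lemma uigamma_S (n : nat) (x : R) : uigamma (S n) x = INR (fact n) * gamma_tail n x.
Proof.
unfold uigamma. apply IntFrom_unique.
pose proof (is_IntFrom_pow_exp n 1 x Rlt_0_1) as H.
rewrite pow1, Rdiv_1_r, Rmult_1_l in H.
apply is_IntFrom_ext with (2 := H). intros t _. simpl. now rewrite Nat.sub_0_r, Rmult_1_l.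
Qed.

Lemma gamma_tail_0 (n : nat) : gamma_tail n 0 = 1.
Proof.
unfold gamma_tail. rewrite Ropp_0, exp_0, Rmult_1_l.
induction n as [| n IH]; [simpl; field |]. rewrite tech5, IH, pow_i by lia. unfold Rdiv. ring.
Qed.

Lemma Gammaf_S (n : nat) : Gammaf (S n) = INR (fact n).
Proof. unfold Gammaf. now rewrite uigamma_S, gamma_tail_0, Rmult_1_r. Qed.

Lemma is_IntFrom_pow_exp_0 (n : nat) (l : R) :
  0 < l -> is_IntFrom 0 (fun t => t ^ n * exp (- (l * t))) (INR (fact n) / l ^ (n + 1)).
Proof.
intros Hl. pose proof (is_IntFrom_pow_exp n l 0 Hl) as H.
now rewrite Rmult_0_r, gamma_tail_0, Rmult_1_r in H.
Qed.

Lemma gamma_tail_pair (n : nat) (th : R) :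
  0 < th -> tail_pair (gamma_pdf (S n) th) (fun x => gamma_tail n (x / th)).
Proof.
intros Hth.
assert (E : forall x, gamma_pdf (S n) th x = x ^ n * exp (- x / th) / (INR (fact n) * th ^ S n)).
{ intros x. unfold gamma_pdf. rewrite Gammaf_S. simpl. now rewrite Nat.sub_0_r. }
pose proof (INR_fact_lt_0 n) as Hf.
assert (Hc : 0 < INR (fact n) * th ^ S n) by (apply Rmult_lt_0_compat; [exact Hf | now apply pow_lt]).
split.
- intros x. apply continuous_ext with (fun x => x ^ n * exp (- x / th) / (INR (fact n) * th ^ S n)).
  { intros; now rewrite E. }
  apply (ex_derive_continuous (fun x => x ^ n * exp (- x / th) / (INR (fact n) * th ^ S n))).
  auto_derive. lra.
- intros x. rewrite E.
  replace (- (x ^ n * exp (- x / th) / (INR (fact n) * th ^ S n)))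
    with (/ th * - ((x / th) ^ n * exp (- (x / th)) / INR (fact n))).
  + apply (is_derive_comp (gamma_tail n) (fun x => x / th)); [apply is_derive_gamma_tail |].
    auto_derive; [exact I | field; lra].
  + replace (- x / th) with (- (x / th)) by (field; lra).
    replace ((x / th) ^ n) with (x ^ n * / th ^ n)
      by (unfold Rdiv; rewrite Rpow_mult_distr, pow_inv; reflexivity).
    simpl. field. repeat split; try lra. apply pow_nonzero; lra.
- destruct (gamma_tail_bound n) as [K HK].
  destruct (pow_le_exp n (/ (2 * th))) as [K' [HK0' HK']]; [apply Rinv_0_lt_compat; lra |].
  (* The density has rate 1/th, half of which absorbs x^n; the tail has rate 1/2 in x/th. Both give
     1/(2 th), and the maximum serves the two bounds at once. *)
  exists (Rmax K (K' / (INR (fact n) * th ^ S n))), (/ (2 * th)).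
  split; [apply Rinv_0_lt_compat; lra |]. intros x Hx. split.
  + rewrite E.
    rewrite Rabs_right.
    2: { apply Rle_ge, Rdiv_le_0_compat; [| exact Hc].
         apply Rmult_le_pos; [now apply pow_le | apply Rlt_le, exp_pos]. }
    apply Rle_trans with (K' / (INR (fact n) * th ^ S n) * exp (- / (2 * th) * x)).
    2: { apply Rmult_le_compat_r; [apply Rlt_le, exp_pos | apply Rmax_r]. }
    replace (- x / th) with (- / (2 * th) * x + - / (2 * th) * x) by (field; lra).
    rewrite exp_plus. unfold Rdiv.
    rewrite (Rmult_assoc K'), (Rmult_comm (/ (INR (fact n) * _)) (exp _)), <- (Rmult_assoc K').
    apply Rmult_le_compat_r; [now apply Rlt_le, Rinv_0_lt_compat |].
    rewrite <- (Rmult_assoc (x ^ n)). apply Rmult_le_compat_r; [apply Rlt_le, exp_pos |].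
    apply Rmult_le_reg_r with (exp (/ (2 * th) * x)); [apply exp_pos |].
    rewrite Rmult_assoc, <- exp_plus. replace (- / (2 * th) * x + / (2 * th) * x) with 0 by ring.
    rewrite exp_0, Rmult_1_r. now apply HK'.
  + replace (- / (2 * th) * x) with (- / 2 * (x / th)) by (field; lra).
    eapply Rle_trans; [apply HK; now apply Rdiv_le_0_compat |].
    apply Rmult_le_compat_r; [apply Rlt_le, exp_pos | apply Rmax_l].
Qed.

(** * The two rates *)

Lemma ln_2_pos : 0 < ln 2.
Proof. rewrite <- ln_1. apply ln_increasing; lra. Qed.

(** Because ln(1 + u) <= u, comparing the ratio inside the logarithm with (1 + u)^2 is enough.
    Taking [u] to be power times gain gives the linear bound demanded by [rate_pair]. *)
Lemma half_log2_bounds (q u : R) :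
  0 <= u -> 1 <= q <= (1 + u) ^ 2 -> 0 <= / 2 * log2 q <= / ln 2 * u.
Proof.
intros Hu [H1 H2]. unfold log2, Rdiv. pose proof ln_2_pos as H.
assert (L1 : 0 <= ln q) by (rewrite <- ln_1; apply ln_le; lra).
assert (L2 : ln q <= 2 * u).
{ apply Rle_trans with (ln ((1 + u) ^ 2)); [apply ln_le; lra |].
  rewrite ln_pow by lra. simpl INR.
  pose proof (exp_ineq1_le u). assert (ln (1 + u) <= u); [| lra].
  rewrite <- (ln_exp u) at 2. apply ln_le; lra. }
assert (0 < / ln 2) by now apply Rinv_0_lt_compat.
split; [| nra]. apply Rmult_le_pos; [lra |]. apply Rmult_le_pos; lra.
Qed.

Lemma half_log2_mono (q q' : R) : 0 < q <= q' -> / 2 * log2 q <= / 2 * log2 q'.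
Proof.
intros Hq. unfold log2, Rdiv. apply Rmult_le_compat_l; [lra |].
apply Rmult_le_compat_r; [apply Rlt_le, Rinv_0_lt_compat, ln_2_pos |]. apply ln_le; lra.
Qed.

Lemma half_log2_gam (r : R) : / 2 * log2 (1 + gam r) = r.
Proof.
unfold gam, log2, Rpower. replace (1 + (exp (2 * r * ln 2) - 1)) with (exp (2 * r * ln 2)) by ring.
rewrite ln_exp. pose proof ln_2_pos. field. lra.
Qed.

(** The expression equals x^2 + 2^(2r) (1 - x^2). Negative [r] is included because [inv_derive] asks
    for differentiability on the whole line. *)
Lemma Psi_arg_pos (r x : R) : 0 <= x < 1 -> 0 < 1 + gam r * (1 - x ^ 2).
Proof.
intros Hx. unfold gam, Rpower. pose proof (exp_pos (2 * r * ln 2)).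
assert (0 < 1 - x ^ 2) by nra.
assert (0 < exp (2 * r * ln 2) * (1 - x ^ 2)) by now apply Rmult_lt_0_compat.
pose proof (pow2_ge_0 x). lra.
Qed.

Lemma ex_derive_Psi (x r : R) : 0 <= x < 1 -> ex_derive (fun r => Psi r x) r.
Proof.
intros Hx. pose proof (Psi_arg_pos r x Hx) as H. unfold Psi, gam, Rpower in *.
auto_derive. repeat split. simpl in *. lra.
Qed.

Lemma gam_ge0 (r : R) : 0 <= r -> 0 <= gam r.
Proof.
intros Hr. unfold gam, Rpower. pose proof (exp_ineq1_le (2 * r * ln 2)).
pose proof ln_2_pos. assert (0 <= r * ln 2) by (apply Rmult_le_pos; lra). lra.
Qed.

Lemma Psi_ge0 (r x : R) : 0 <= r -> 0 <= x < 1 -> 0 <= Psi r x.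
Proof.
intros Hr Hx. unfold Psi. assert (1 <= sqrt (1 + gam r * (1 - x ^ 2))); [| lra].
rewrite <- sqrt_1 at 1. apply sqrt_le_1_alt. pose proof (gam_ge0 r Hr).
assert (0 <= gam r * (1 - x ^ 2)) by (apply Rmult_le_pos; nra). lra.
Qed.

Lemma Psi_0 (x : R) : Psi 0 x = 0.
Proof.
unfold Psi, gam. rewrite Rmult_0_r, Rpower_O by lra.
replace (1 + (1 - 1) * (1 - x ^ 2)) with 1 by ring. rewrite sqrt_1. ring.
Qed.

Lemma Psi_sqr (r x : R) : 0 <= x < 1 -> (Psi r x + 1) ^ 2 = 1 + gam r * (1 - x ^ 2).
Proof.
intros Hx. unfold Psi.
replace (sqrt (1 + gam r * (1 - x ^ 2)) - 1 + 1) with (sqrt (1 + gam r * (1 - x ^ 2))) by ring.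
apply pow2_sqrt, Rlt_le, Psi_arg_pos, Hx.
Qed.

Lemma quadrant_const (k : R) : continuous_quadrant (fun _ _ => k).
Proof. intros z. apply continuous_const. Qed.

Lemma quadrant_x : continuous_quadrant (fun x _ => x).
Proof. apply (quadrant_fst (fun x => x)), halfline_of_continuous. intros; apply continuous_id. Qed.

Lemma quadrant_y : continuous_quadrant (fun _ y => y).
Proof. apply (quadrant_snd (fun x => x)), halfline_of_continuous. intros; apply continuous_id. Qed.

Lemma quadrant_opp (f : R -> R -> R) :
  continuous_quadrant f -> continuous_quadrant (fun x y => - f x y).
Proof.
intros Hf. apply (quadrant_comp Ropp); [exact Hf |]. intros x y _ _.
apply (continuous_opp (fun x : R => x) (f x y)), continuous_id.
Qed.

Lemma quadrant_inv (f : R -> R -> R) :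
  continuous_quadrant f -> (forall x y, 0 <= x -> 0 <= y -> f x y <> 0) ->
  continuous_quadrant (fun x y => / f x y).
Proof.
intros Hf H0. apply (quadrant_comp Rinv); [exact Hf |]. intros x y Hx Hy.
apply continuous_Rinv, H0; assumption.
Qed.

Lemma quadrant_pow (f : R -> R -> R) (n : nat) :
  continuous_quadrant f -> continuous_quadrant (fun x y => f x y ^ n).
Proof.
intros Hf. apply (quadrant_comp (fun t => t ^ n)); [exact Hf |]. intros x y _ _.
apply (ex_derive_continuous (fun t => t ^ n)). auto_derive. exact I.
Qed.

Lemma quadrant_half_log2 (f : R -> R -> R) :
  continuous_quadrant f -> (forall x y, 0 <= x -> 0 <= y -> 0 < f x y) ->
  continuous_quadrant (fun x y => / 2 * log2 (f x y)).
Proof.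
intros Hf H0. apply (quadrant_comp (fun t => / 2 * log2 t)); [exact Hf |]. intros x y Hx Hy.
unfold log2. apply (ex_derive_continuous (fun t => / 2 * (ln t / ln 2))).
auto_derive. now apply H0.
Qed.

Lemma quadrant_Psi (f : R -> R -> R) :
  continuous_quadrant f -> continuous_quadrant (fun r y => Psi r (f r y)).
Proof.
intros Hf.
apply (quadrant_plus (fun r y => sqrt (1 + gam r * (1 - f r y ^ 2))) (fun _ _ => - (1)));
  [| apply quadrant_const].
apply (quadrant_comp sqrt); [| intros; apply continuous_sqrt].
apply (quadrant_plus (fun _ _ => 1) (fun r y => gam r * (1 - f r y ^ 2))); [apply quadrant_const |].
apply (quadrant_mult (fun r y => gam r) (fun r y => 1 - f r y ^ 2)).
- apply quadrant_fst, halfline_of_continuous. intros r. apply (ex_derive_continuous gam).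
  unfold gam, Rpower. auto_derive. exact I.
- apply (quadrant_plus (fun _ _ => 1) (fun r y => - f r y ^ 2)); [apply quadrant_const |].
  apply (quadrant_opp (fun r y => f r y ^ 2)). now apply quadrant_pow.
Qed.

(** The constant rule is tried first, so a denominator free of both variables creates no side
    condition; otherwise its nonvanishing on the quadrant is left as a goal. *)
Ltac quadrant :=
  unfold Rdiv, Rminus;
  repeat match goal with
  | |- continuous_quadrant (fun _ _ => ?k) => apply (quadrant_const k)
  | |- continuous_quadrant (fun x _ => x) => apply quadrant_x
  | |- continuous_quadrant (fun _ y => y) => apply quadrant_y
  | |- continuous_quadrant (fun x y => @?f x y + @?g x y) => apply (quadrant_plus f g)
  | |- continuous_quadrant (fun x y => @?f x y * @?g x y) => apply (quadrant_mult f g)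
  | |- continuous_quadrant (fun x y => - @?f x y) => apply (quadrant_opp f)
  | |- continuous_quadrant (fun x y => / @?f x y) => apply (quadrant_inv f)
  | |- continuous_quadrant (fun x y => @?f x y ^ ?n) => apply (quadrant_pow f n)
  | |- continuous_quadrant (fun x y => Psi x (@?f x y)) => apply (quadrant_Psi f)
  end.

(** The source gain [a] solving R_sr = r. With A = Pr b + 1 and x = Pr b Cx / A the equation becomes
    (Ps a + A)^2 = A^2 (1 + gam r (1 - x^2)), that is Ps a + A = A (Psi r x + 1). *)
Definition thr_sr (Ps Pr Cx r b : R) : R :=
  (Pr * b + 1) / Ps * Psi r (Pr * b * Cx / (Pr * b + 1)).

(** The relay gain [c] solving R_rd = r. With D = Ps d + 1, completing the square gives ((1 - Cx^2)
    Pr c + D)^2 = D^2 (1 + gam r (1 - Cx^2)). *)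
Definition thr_rd (Ps Pr Cx r d : R) : R :=
  (Ps * d + 1) / (Pr * (1 - Cx ^ 2)) * Psi r Cx.

Lemma rate_pair_sr (Ps Pr Cx : R) :
  0 < Ps -> 0 < Pr -> 0 <= Cx < 1 -> rate_pair (R_sr Ps Pr Cx) (thr_sr Ps Pr Cx).
Proof.
intros HPs HPr HC.
assert (HA : forall b, 0 <= b -> 1 <= Pr * b + 1) by (intros b Hb; nra).
assert (HB : forall b, 0 <= b -> 0 <= Pr * b * Cx <= Pr * b).
{ intros b Hb. assert (0 <= Pr * b) by nra. nra. }
(* Replacing Cx by 1 lowers the right side to (Pr b + 1)^2 - (Pr b)^2 = (Pr b + 1) + Pr b. *)
assert (HD : forall b, 0 <= b -> Pr * b + 1 <= (Pr * b + 1) ^ 2 - (Pr * b * Cx) ^ 2).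
{ intros b Hb. specialize (HA b Hb). specialize (HB b Hb). nra. }
assert (Hx : forall b, 0 <= b -> 0 <= Pr * b * Cx / (Pr * b + 1) < 1).
{ intros b Hb. specialize (HA b Hb). specialize (HB b Hb). split.
  - apply Rdiv_le_0_compat; lra.
  - apply Rmult_lt_reg_r with (Pr * b + 1); [lra |]. field_simplify; [| lra]. lra. }
assert (HN : forall a b, 0 <= a -> 0 <= b ->
  (Pr * b + 1) ^ 2 <= (Ps * a + Pr * b + 1) ^ 2).
{ intros a b Ha Hb. specialize (HA b Hb). apply pow_incr. nra. }
assert (Hpos : forall a b, 0 <= a -> 0 <= b ->
  0 < ((Ps * a + Pr * b + 1) ^ 2 - (Pr * b * Cx) ^ 2) / ((Pr * b + 1) ^ 2 - (Pr * b * Cx) ^ 2)).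
{ intros a b Ha Hb. specialize (HA b Hb). specialize (HD b Hb). specialize (HN a b Ha Hb).
  apply Rdiv_lt_0_compat; lra. }
split.
- apply (quadrant_half_log2 (fun a b => ((Ps * a + Pr * b + 1) ^ 2 - (Pr * b * Cx) ^ 2)
            / ((Pr * b + 1) ^ 2 - (Pr * b * Cx) ^ 2))); [| exact Hpos].
  quadrant. intros a b _ Hb. specialize (HA b Hb). specialize (HD b Hb). lra.
- unfold thr_sr. quadrant. intros _ b _ Hb. specialize (HA b Hb). lra.
- intros r b Hb. unfold thr_sr.
  apply (ex_derive_scal (fun r => Psi r (Pr * b * Cx / (Pr * b + 1)))). now apply ex_derive_Psi, Hx.
- intros b Hb. unfold thr_sr. rewrite Psi_0. ring.
- intros r b Hr Hb. unfold thr_sr. specialize (HA b Hb). apply Rmult_le_pos.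
  + apply Rdiv_le_0_compat; lra.
  + apply Psi_ge0; auto.
- intros r b Hr Hb. specialize (HA b Hb). specialize (HD b Hb).
  unfold R_sr. transitivity (/ 2 * log2 (1 + gam r)); [| apply half_log2_gam]. do 2 f_equal.
  replace (Ps * thr_sr Ps Pr Cx r b + Pr * b + 1)
    with ((Pr * b + 1) * (Psi r (Pr * b * Cx / (Pr * b + 1)) + 1)).
  2: { unfold thr_sr. field. lra. }
  rewrite Rpow_mult_distr, Psi_sqr by (now apply Hx). field. split; lra.
- intros a a' b Ha Hb. apply half_log2_mono. split; [apply Hpos; lra |].
  specialize (HA b Hb). specialize (HD b Hb).
  apply Rmult_le_compat_r; [apply Rlt_le, Rinv_0_lt_compat; lra |].
  assert ((Ps * a + Pr * b + 1) ^ 2 <= (Ps * a' + Pr * b + 1) ^ 2); [| lra].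
  apply pow_incr. nra.
- exists (/ ln 2 * Ps). split.
  { apply Rmult_lt_0_compat; [apply Rinv_0_lt_compat, ln_2_pos | exact HPs]. }
  intros a b Ha Hb. rewrite Rmult_assoc. apply half_log2_bounds; [nra |].
  specialize (HN a b Ha Hb). specialize (HA b Hb). specialize (HD b Hb).
  assert (0 <= Ps * a) by nra. set (s := Ps * a) in *.
  set (D := (Pr * b + 1) ^ 2 - (Pr * b * Cx) ^ 2) in *.
  split; apply Rmult_le_reg_r with D; try lra.
  + unfold Rdiv. rewrite Rmult_assoc, Rinv_l, Rmult_1_r by lra. unfold D; lra.
  + unfold Rdiv. rewrite Rmult_assoc, Rinv_l, Rmult_1_r by lra.
    replace ((s + Pr * b + 1) ^ 2 - (Pr * b * Cx) ^ 2)
      with (s ^ 2 + 2 * s * (Pr * b + 1) + D) by (unfold D; ring).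
    (* (1 + s)^2 D minus the numerator is 2 s (D - (Pr b + 1)) + s^2 (D - 1). *)
    assert (0 <= s * (D - (Pr * b + 1))) by (apply Rmult_le_pos; lra).
    assert (0 <= s ^ 2 * (D - 1)) by (apply Rmult_le_pos; [apply pow2_ge_0 | lra]).
    nra.
Qed.

Lemma rate_pair_rd (Ps Pr Cx : R) :
  0 < Ps -> 0 < Pr -> 0 <= Cx < 1 -> rate_pair (R_rd Ps Pr Cx) (thr_rd Ps Pr Cx).
Proof.
intros HPs HPr HC.
assert (HA : forall d, 0 <= d -> 1 <= Ps * d + 1) by (intros d Hd; nra).
assert (HC2 : 0 < 1 - Cx ^ 2 <= 1) by nra.
assert (HPC : 0 < Pr * (1 - Cx ^ 2)) by (apply Rmult_lt_0_compat; lra).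
(* As a polynomial in Pr c the numerator has nonnegative coefficients because Cx < 1; positivity and
   monotonicity in the gain are read off this form. *)
assert (E : forall c d, (Pr * c + Ps * d + 1) ^ 2 - (Pr * c * Cx) ^ 2
  = (1 - Cx ^ 2) * (Pr * c) ^ 2 + 2 * (Pr * c) * (Ps * d + 1) + (Ps * d + 1) ^ 2) by (intros; ring).
assert (HN : forall c d, 0 <= c -> 0 <= d ->
  (Ps * d + 1) ^ 2 <= (Pr * c + Ps * d + 1) ^ 2 - (Pr * c * Cx) ^ 2).
{ intros c d Hc Hd. specialize (HA d Hd). rewrite E. assert (0 <= Pr * c) by nra.
  assert (0 <= (1 - Cx ^ 2) * (Pr * c) ^ 2) by (apply Rmult_le_pos; [lra | apply pow2_ge_0]).
  assert (0 <= Pr * c * (Ps * d + 1)) by (apply Rmult_le_pos; lra). lra. }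
assert (HD : forall d, 0 <= d -> Ps * d + 1 <= (Ps * d + 1) ^ 2).
{ intros d Hd. specialize (HA d Hd). nra. }
assert (Hpos : forall c d, 0 <= c -> 0 <= d ->
  0 < ((Pr * c + Ps * d + 1) ^ 2 - (Pr * c * Cx) ^ 2) / (Ps * d + 1) ^ 2).
{ intros c d Hc Hd. specialize (HA d Hd). specialize (HD d Hd). specialize (HN c d Hc Hd).
  apply Rdiv_lt_0_compat; lra. }
split.
- apply (quadrant_half_log2 (fun c d => ((Pr * c + Ps * d + 1) ^ 2 - (Pr * c * Cx) ^ 2)
            / (Ps * d + 1) ^ 2)); [| exact Hpos].
  quadrant. intros c d _ Hd. specialize (HA d Hd). specialize (HD d Hd). lra.
- unfold thr_rd. quadrant.
- intros r d Hd. unfold thr_rd.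
  apply (ex_derive_scal (fun r => Psi r Cx)). now apply ex_derive_Psi.
- intros d Hd. unfold thr_rd. rewrite Psi_0. ring.
- intros r d Hr Hd. unfold thr_rd. specialize (HA d Hd). apply Rmult_le_pos.
  + apply Rdiv_le_0_compat; lra.
  + apply Psi_ge0; auto.
- intros r d Hr Hd. specialize (HA d Hd). specialize (HD d Hd).
  unfold R_rd. transitivity (/ 2 * log2 (1 + gam r)); [| apply half_log2_gam]. do 2 f_equal.
  rewrite E. pose proof (Psi_sqr r Cx HC) as Hq. unfold thr_rd. set (q := Psi r Cx) in *.
  (* Eliminating [gam r] in favour of [q] removes the square root and leaves a rational identity. *)
  assert (Hq' : gam r = ((q + 1) ^ 2 - 1) / (1 - Cx ^ 2)) by (rewrite Hq; field; lra).
  rewrite Hq'. field. repeat split; lra.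
- intros c c' d Hc Hd. apply half_log2_mono. split; [apply Hpos; lra |].
  specialize (HA d Hd). specialize (HD d Hd).
  apply Rmult_le_compat_r; [apply Rlt_le, Rinv_0_lt_compat; lra |].
  rewrite !E. assert (0 <= Pr * c <= Pr * c') by nra.
  assert ((Pr * c) ^ 2 <= (Pr * c') ^ 2) by (apply pow_incr; lra). nra.
- exists (/ ln 2 * Pr). split.
  { apply Rmult_lt_0_compat; [apply Rinv_0_lt_compat, ln_2_pos | exact HPr]. }
  intros c d Hc Hd. rewrite Rmult_assoc. apply half_log2_bounds; [nra |].
  specialize (HN c d Hc Hd). specialize (HA d Hd). specialize (HD d Hd).
  rewrite E in *. assert (0 <= Pr * c) by nra. set (t := Pr * c) in *.
  set (D := Ps * d + 1) in *.
  split; apply Rmult_le_reg_r with (D ^ 2); try lra.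
  + unfold Rdiv. rewrite Rmult_assoc, Rinv_l, Rmult_1_r by lra. lra.
  + unfold Rdiv. rewrite Rmult_assoc, Rinv_l, Rmult_1_r by lra.
    (* (1 + t)^2 D^2 minus the numerator is 2 t (D^2 - D) + t^2 (D^2 - (1 - Cx^2)). *)
    assert (0 <= t * (D ^ 2 - D)) by (apply Rmult_le_pos; lra).
    assert (0 <= t ^ 2 * (D ^ 2 - (1 - Cx ^ 2))) by (apply Rmult_le_pos; [apply pow2_ge_0 | lra]).
    lra.
Qed.

(** * The closed form *)

Lemma gamma_tail_affine_expand (n : nat) (s b x : R) :
  gamma_tail n (b * (s * x + 1)) =
  sum_f_R0 (fun m => sum_f_R0 (fun k =>
    Binomial.C m k * s ^ k * b ^ m * exp (- b) / INR (fact m)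
      * (x ^ k * exp (- (s * b * x)))) m) n.
Proof.
unfold gamma_tail. rewrite scal_sum. apply sum_eq. intros m _.
rewrite Rpow_mult_distr, binomial.
replace (exp (- (b * (s * x + 1)))) with (exp (- b) * exp (- (s * b * x)))
  by (rewrite <- exp_plus; f_equal; ring).
transitivity (b ^ m / INR (fact m) * (exp (- b) * exp (- (s * b * x)))
  * sum_f_R0 (fun i => Binomial.C m i * (s * x) ^ i * 1 ^ (m - i)) m).
{ unfold Rdiv. ring. }
rewrite scal_sum. apply sum_eq. intros k _.
rewrite pow1, Rpow_mult_distr. unfold Rdiv. ring.
Qed.

Lemma sum_mult_r (f : nat -> R) (n : nat) (x : R) :
  sum_f_R0 f n * x = sum_f_R0 (fun i => f i * x) n.
Proof. now rewrite Rmult_comm, scal_sum. Qed.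

(** Each term of the expansion times the density is a complete gamma integral of shape k + n' + 1
    and rate s b + 1/th; the powers of Ps beta_r + 1/theta_sd in the closed form originate here. *)
Lemma is_IntFrom_gamma_tail_pdf (n n' : nat) (s b th : R) :
  0 < s -> 0 <= b -> 0 < th ->
  is_IntFrom 0 (fun x => gamma_tail n (b * (s * x + 1)) * gamma_pdf (S n') th x)
    (sum_f_R0 (fun m => sum_f_R0 (fun k =>
       Binomial.C m k * s ^ k * b ^ m * exp (- b) / INR (fact m)
       / (INR (fact n') * th ^ S n')
       * (INR (fact (k + n')) / (s * b + / th) ^ (k + n' + 1))) m) n).
Proof.
intros Hs Hb Hth.
assert (Hl : 0 < s * b + / th).
{ assert (0 <= s * b) by nra. pose proof (Rinv_0_lt_compat th Hth). lra. }
apply is_IntFrom_ext with (fun x => sum_f_R0 (fun m => sum_f_R0 (fun k =>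
       Binomial.C m k * s ^ k * b ^ m * exp (- b) / INR (fact m)
       / (INR (fact n') * th ^ S n')
       * (x ^ (k + n') * exp (- ((s * b + / th) * x)))) m) n).
- intros x _. rewrite gamma_tail_affine_expand, sum_mult_r.
  apply sum_eq. intros m _. rewrite sum_mult_r. apply sum_eq. intros k _.
  unfold gamma_pdf. rewrite Gammaf_S. replace (S n' - 1)%nat with n' by lia.
  replace (exp (- ((s * b + / th) * x))) with (exp (- (s * b * x)) * exp (- x / th))
    by (rewrite <- exp_plus; f_equal; field; lra).
  rewrite pow_add. unfold Rdiv. ring.
- apply is_IntFrom_sum. intros m _. apply is_IntFrom_sum. intros k _.
  apply is_IntFrom_scal. now apply is_IntFrom_pow_exp_0.
Qed.

(** The factors are P(R_sr > r | g_rr = x), P(R_rd > r) and the density of g_rr. The double sum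
    comes from the second factor alone, through beta_r (Ps d + 1) = [thr_rd Ps Pr Cx r d / t3]. *)
Lemma RHS_integrand_factor (Ps Pr Cx : R) (n1 n2 n3 n4 : nat) (t1 t2 t3 t4 x r : R) :
  0 < Ps -> 0 < Pr -> 0 <= Cx < 1 -> 0 < t1 -> 0 < t2 -> 0 < t3 -> 0 < t4 -> 0 <= r -> 0 <= x ->
  RHS_integrand Ps Pr Cx (S n1) (S n2) (S n3) (S n4) t1 t2 t3 t4 x r
  = gamma_tail n1 (thr_sr Ps Pr Cx r x / t1)
    * IntFrom 0 (fun d => gamma_tail n3 (thr_rd Ps Pr Cx r d / t3) * gamma_pdf (S n4) t4 d)
    * gamma_pdf (S n2) t2 x.
Proof.
intros HPs HPr HC H1 H2 H3 H4 Hr Hx.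
assert (HC2 : 0 < 1 - Cx ^ 2) by nra.
pose proof (Psi_ge0 r Cx Hr HC) as HPsi.
assert (Hb : 0 <= beta Pr t3 Cx r).
{ unfold beta. apply Rdiv_le_0_compat; [exact HPsi |]. repeat apply Rmult_lt_0_compat; lra. }
set (b := beta Pr t3 Cx r) in *.
rewrite (IntFrom_ext 0 _ (fun d => gamma_tail n3 (b * (Ps * d + 1)) * gamma_pdf (S n4) t4 d)).
2: { intros d _. do 2 f_equal. unfold b, beta, thr_rd. field. repeat split; lra. }
rewrite (IntFrom_unique _ _ _ (is_IntFrom_gamma_tail_pdf n3 n4 Ps b t4 HPs Hb H4)).
rewrite Rmult_comm, <- Rmult_assoc, Rmult_comm, sum_mult_r.
unfold RHS_integrand. fold b. replace (S n3 - 1)%nat with n3 by lia.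
apply sum_eq. intros m _. rewrite sum_mult_r. apply sum_eq. intros k _.
unfold gamma_pdf. rewrite Nat.add_1_r, Nat.add_1_r, Nat.add_succ_r, !Gammaf_S, uigamma_S.
replace (S n2 - 1)%nat with n2 by lia.
replace ((Pr * x + 1) / (Ps * t1) * Psi r (Pr * x * Cx / (Pr * x + 1)))
  with (thr_sr Ps Pr Cx r x / t1) by (unfold thr_sr; field; repeat split; nra).
replace (exp (- (b + x / t2))) with (exp (- b) * exp (- x / t2))
  by (rewrite <- exp_plus; f_equal; field; lra).
assert (0 < Ps * b + / t4).
{ assert (0 <= Ps * b) by nra. pose proof (Rinv_0_lt_compat t4 H4). lra. }
set (L := Ps * b + / t4) in *.
assert (HL : L ^ S (k + n4) <> 0) by (apply pow_nonzero; lra).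
assert (HT2 : t2 ^ S n2 <> 0) by (apply pow_nonzero; lra).
assert (HT4 : t4 ^ S n4 <> 0) by (apply pow_nonzero; lra).
pose proof (INR_fact_neq_0 n1). pose proof (INR_fact_neq_0 n2).
pose proof (INR_fact_neq_0 n4). pose proof (INR_fact_neq_0 m).
set (P := L ^ S (k + n4)) in *. set (T2 := t2 ^ S n2) in *. set (T4 := t4 ^ S n4) in *.
set (g := gamma_tail n1 (thr_sr Ps Pr Cx r x / t1)). clearbody P T2 T4 g.
field. repeat split; assumption.
Qed.

Theorem theorem6 (Ps Pr : R) (m_sr m_rr m_rd m_sd : nat)
  (pi_sr pi_rr pi_rd pi_sd Cx : R) :
  0 < Ps -> 0 < Pr ->
  (1 <= m_sr)%nat -> (1 <= m_rr)%nat -> (1 <= m_rd)%nat -> (1 <= m_sd)%nat ->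
  0 < pi_sr -> 0 < pi_rr -> 0 < pi_rd -> 0 < pi_sd ->
  0 <= Cx < 1 ->
  let t_sr := pi_sr / INR m_sr in
  let t_rr := pi_rr / INR m_rr in
  let t_rd := pi_rd / INR m_rd in
  let t_sd := pi_sd / INR m_sd in
  exists RE : R,
    is_Expect4 m_sr m_rr m_rd m_sd t_sr t_rr t_rd t_sd
      (fun g_sr g_rr g_rd g_sd =>
         Rmin (R_sr Ps Pr Cx g_sr g_rr) (R_rd Ps Pr Cx g_rd g_sd)) RE
    /\ is_IntFrom 0 (fun r =>
         IntFrom 0 (fun x =>
           RHS_integrand Ps Pr Cx m_sr m_rr m_rd m_sd t_sr t_rr t_rd t_sd x r)) RE.
Proof.
intros HPs HPr Hsr Hrr Hrd Hsd Psr Prr Prd Psd HC t_sr t_rr t_rd t_sd.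
assert (Hsr' : 0 < t_sr) by (apply Rdiv_lt_0_compat; [| apply lt_0_INR]; assumption).
assert (Hrr' : 0 < t_rr) by (apply Rdiv_lt_0_compat; [| apply lt_0_INR]; assumption).
assert (Hrd' : 0 < t_rd) by (apply Rdiv_lt_0_compat; [| apply lt_0_INR]; assumption).
assert (Hsd' : 0 < t_sd) by (apply Rdiv_lt_0_compat; [| apply lt_0_INR]; assumption).
clearbody t_sr t_rr t_rd t_sd.
destruct m_sr as [| n1]; [lia |]. destruct m_rr as [| n2]; [lia |].
destruct m_rd as [| n3]; [lia |]. destruct m_sd as [| n4]; [lia |].
destruct (expectation_Rmin_tails _ _ _ _ _ _ _ _ _ _ _ _
  (gamma_tail_pair n1 t_sr Hsr') (gamma_tail_pair n2 t_rr Hrr')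
  (gamma_tail_pair n3 t_rd Hrd') (gamma_tail_pair n4 t_sd Hsd')
  (rate_pair_sr Ps Pr Cx HPs HPr HC) (rate_pair_rd Ps Pr Cx HPs HPr HC)) as [v [V1 V2]].
exists v. split; [exact V1 |].
apply is_IntFrom_ext with (2 := V2). intros r Hr. apply IntFrom_ext. intros x Hx.
symmetry. now apply RHS_integrand_factor.
Qed.
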